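(* Let $\theta\in[1/2,1]$ be fixed (and $\epsilon>0$ fixed). The stochastic $\theta$-method $$\begin{pmatrix}P_{n+1}\\Q_{n+1}\end{pmatrix}=A_\theta(h)\begin{pmatrix}P_n\\Q_n\end{pmatrix}+\sqrt\epsilon\,b_\theta(h)\,\Delta W_n,\quad n=0,1,2,\dots,$$ with $$A_\theta(h)=\frac1{1+\triangle}\begin{pmatrix}1-(\theta h^2+\nu h)(1-\theta)&-h\\ h&1-\theta(1-\theta)h^2+\nu\theta h\end{pmatrix},\quad b_\theta(h)=\frac1{1+\triangle}\begin{pmatrix}1\\\theta h\end{pmatrix},\quad \triangle=\theta(\theta h^2+\nu h),$$ for the Langevin equation $dP=-Q\,dt-\nu P\,dt+\sqrt\epsilon\,dW$, $dQ=P\,dt$, asymptotically preserves the LDP of $\{\mu_{\nu,\epsilon}\}_{\nu>0}$ (as $\nu\to\infty$) if and only if $\theta=1/2$.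
   Context: $W$ is a one-dimensional standard Wiener process, $h>0$ is the step-size, $t_n=nh$, $\Delta W_n=W(t_{n+1})-W(t_n)$, $\nu>0$, and $(P_0,Q_0)=(P(0),Q(0))=(p,q)\in\mathbb R^2$ is a deterministic initial value. Invariant measure: a probability measure $\mu$ on $\mathbb R^2$ is invariant for the Markov chain $\{(P_n,Q_n)\}$ if $\int \mathbf E[\varphi(P_n,Q_n)\mid (P_0,Q_0)=x]\,\mu(dx)=\int\varphi\,d\mu$ for all bounded continuous $\varphi$ and all $n$. $\mu_{\nu,\epsilon}$ denotes the unique invariant measure of the Langevin equation above, $d\mu_{\nu,\epsilon}\propto\exp\{-\frac{\nu}{\epsilon}(p^2+q^2)\}dp\,dq$; for fixed $\epsilon$, the family $\{\mu_{\nu,\epsilon}\}_{\nu>0}$ satisfies the LDP as $\nu\to\infty$ with rate function $(p^2+q^2)/\epsilon$. LDP as $\nu\to\infty$: a rate function is a lower semicontinuous map $J:\mathbb R^2\to[0,\infty]$. A family $\{m_\nu\}$ of Borel probability measures on $\mathbb R^2$ (defined for all sufficiently large $\nu$) satisfies the LDP with rate function $J$ if $\liminf_{\nu\to\infty}\frac1\nu\ln m_\nu(U)\ge-\inf_U J$ for all open $U$ and $\limsup_{\nu\to\infty}\frac1\nu\ln m_\nu(C)\le-\inf_C J$ for all closed $C$. Asymptotic preservation: with $\epsilon>0$ fixed, a numerical method is said to asymptotically preserve the LDP of $\{\mu_{\nu,\epsilon}\}_{\nu>0}$ if there is $h_0>0$ such that for every $h\le h_0$ the method has a unique invariant measure $\mu^h_{\nu,\epsilon}$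 for all sufficiently large $\nu>0$, the family $\{\mu^h_{\nu,\epsilon}\}_{\nu>0}$ satisfies the LDP (as $\nu\to\infty$) with a rate function $J^h$, and $\lim_{h\to0}J^h(p,q)=(p^2+q^2)/\epsilon$ for all $(p,q)\in\mathbb R^2$. *)

(* Defs.v *)
From HB Require Import structures.
From mathcomp Require Import all_boot all_order all_algebra.
From mathcomp Require Import all_classical all_reals all_analysis.
From mathcomp Require Import measurable_realfun.

Set Implicit Arguments.
Unset Strict Implicit.
Unset Printing Implicit Defensive.

Import Order.TTheory GRing.Theory Num.Theory.
Import numFieldNormedType.Exports.

Local Open Scope classical_set_scope.
Local Open Scope ring_scope.

(* For a finite family it suffices to test the product rule on the whole
   index set, since some of the Borel sets may be taken to be [set: R]. *)
Definition independent_RVs (R : realType) (d : measure_display)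
    (Omega : measurableType d) (P : probability Omega R) (n : nat)
    (X : 'I_n -> {RV P >-> R}) : Prop :=
  forall B : 'I_n -> set R, (forall i, measurable (B i)) ->
    P (\bigcap_(i in [set: 'I_n]) (X i @^-1` B i)) =
    (\prod_(i < n) P (X i @^-1` B i))%E.

Arguments independent_RVs {R d Omega} P {n} X.

(* Standard Wiener process on [0, +oo); the values at negative times are
   irrelevant.  The second argument of normal_prob is the standard deviation,
   hence the square root. *)
Record wiener_process (R : realType) (d : measure_display)
    (Omega : measurableType d) (P : probability Omega R)
    (W : R -> {RV P >-> R}) : Prop := WienerProcess {
  wiener_start : {ae P, forall omega, W 0 omega = 0} ;
  wiener_increment : forall s t : R, 0 <= s -> s < t ->
    forall B : set R, measurable B ->
      distribution P (W t - W s) B = normal_prob 0 (Num.sqrt (t - s)) B ;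
  wiener_independent : forall (n : nat) (t : nat -> R),
    0 <= t 0%N -> (forall i, t i <= t i.+1) ->
    independent_RVs P (fun i : 'I_n => W (t i.+1) - W (t i)) ;
  wiener_continuous : {ae P, forall omega,
    {within `[0, +oo[, continuous (fun t => W t omega)}}
}.

Arguments wiener_process {R d Omega} P W.

Section asymptotic_preservation.
Context {R : realType}.
Implicit Types (m : probability (R * R)%type R) (J : R * R -> \bar R).

Definition rate_function J : Prop :=
  (forall x, 0%E <= J x)%E /\ lower_semicontinuous J.

(* m nu is the member of the family with parameter nu; only its values for
   large nu matter. *)
Definition satisfies_LDP (m : R -> probability (R * R)%type R) J : Prop :=
  (forall U : set (R * R), open U ->
    (- ereal_inf (J @` U) <=
       limf_einf (fun nu : R => (nu^-1)%:E * lne (m nu U)) (pinfty_nbhs R))%E) /\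
  (forall C : set (R * R), closed C ->
    (limf_esup (fun nu : R => (nu^-1)%:E * lne (m nu C)) (pinfty_nbhs R)
       <= - ereal_inf (J @` C))%E).

Section chain.
Context {d : measure_display} {Omega : measurableType d}.
Variable P : probability Omega R.

(* X x n is the n-th state of the chain started at the deterministic point x. *)
Definition invariant_measure (X : R * R -> nat -> Omega -> R * R) m : Prop :=
  forall phi : R * R -> R, continuous phi -> bounded_fun phi ->
  forall n : nat,
    (\int[m]_x 'E_P[fun omega => phi (X x n omega)] = \int[m]_x (phi x)%:E)%E.

(* Measures are compared on measurable sets only: a value of type probability
   is unconstrained on the other sets. *)
Definition unique_invariant_measure (X : R * R -> nat -> Omega -> R * R) m
    : Prop :=
  invariant_measure X m /\
  forall m', invariant_measure X m' ->
    forall A : set (R * R), measurable A -> m' A = m A.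

(* Rate function of the invariant measures
   exp (- nu / epsilon * (p ^ 2 + q ^ 2)) dp dq (up to normalization) of the
   Langevin equation. *)
Definition langevin_rate (epsilon : R) (x : R * R) : \bar R :=
  ((x.1 ^+ 2 + x.2 ^+ 2) / epsilon)%:E.

(* X nu h is the method with friction nu and step-size h. *)
Definition asymptotically_preserves_LDP (epsilon : R)
    (X : R -> R -> R * R -> nat -> Omega -> R * R) : Prop :=
  exists2 h0 : R, 0 < h0 &
  exists J : R -> R * R -> \bar R,
    (forall h : R, 0 < h -> h <= h0 ->
       exists m : R -> probability (R * R)%type R,
         [/\ \forall nu \near +oo, unique_invariant_measure (X nu h) (m nu),
             rate_function (J h) &
             satisfies_LDP m (J h)]) /\
    (forall x : R * R, J h x @[h --> 0^'+] --> langevin_rate epsilon x).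

End chain.
End asymptotic_preservation.

Section theta_method.
Context {R : realType}.
Variables (theta nu h : R).

Definition theta_delta : R := theta * (theta * h ^+ 2 + nu * h).

Definition theta_A : 'M[R]_2 :=
  (1 + theta_delta)^-1 *: \matrix_(i, j)
    (if i == 0
     then if j == 0 then 1 - (theta * h ^+ 2 + nu * h) * (1 - theta) else - h
     else if j == 0 then h
          else 1 - theta * (1 - theta) * h ^+ 2 + nu * theta * h).

Definition theta_b : 'cV[R]_2 :=
  (1 + theta_delta)^-1 *: \col_i (if i == 0 then 1 else theta * h).

Definition col_of_pair (x : R * R) : 'cV[R]_2 :=
  \col_i (if i == 0 then x.1 else x.2).

Definition pair_of_col (v : 'cV[R]_2) : R * R := (v 0 0, v 1 0).

Fixpoint theta_chain (epsilon : R) (d : measure_display)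
    (Omega : measurableType d) (P : probability Omega R)
    (W : R -> {RV P >-> R}) (x : R * R) (n : nat) (omega : Omega) : R * R :=
  if n is n'.+1 then
    pair_of_col
      (theta_A *m col_of_pair (theta_chain epsilon W x n' omega) +
       (Num.sqrt epsilon * (W (n'.+1%:R * h) omega - W (n'%:R * h) omega))
         *: theta_b)
  else x.

End theta_method.

(* Main.v *)
Require Import Defs.
From HB Require Import structures.
From mathcomp Require Import all_boot all_order all_algebra.
From mathcomp Require Import all_classical all_reals all_analysis.
From mathcomp Require Import measurable_realfun.
From mathcomp Require Import ring lra.

Import Order.TTheory GRing.Theory Num.Theory.
Import numFieldNormedType.Exports.

Local Open Scope classical_set_scope.
Local Open Scope ring_scope.

(** Write the equation as dX = M X dt + sqrt(epsilon) e1 dW with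
    M = [[-nu, -1], [1, 0]].  The method is X' = A X + sqrt(epsilon) b (dW) with
    A = (1 - theta h M)^-1 (1 + (1 - theta) h M) and b = (1 - theta h M)^-1 e1.
    Put k = (2 theta - 1) h >= 0.  Multiplying out the resolvents, the covariance
    equation Sigma = A Sigma A^T + epsilon h b b^T of an invariant Gaussian
    becomes
      - (M Sigma + Sigma M^T) + k M Sigma M^T = epsilon e1 e1^T.

    If theta = 1/2 then k = 0 and Sigma = epsilon / (2 nu) solves it: the method
    has exactly the invariant measure of the Langevin equation, for every step
    size, and its rate function is (p^2 + q^2) / epsilon already for h fixed.
    If theta > 1/2, the momentum variance is of order epsilon / (k nu^2), while a
    large deviation principle at speed nu with a finite rate needs order 1 / nu.
    So the rate function is +oo off the line p = 0, for every h, and cannot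
    converge to (p^2 + q^2) / epsilon at (1, 0).

    The proof has four ingredients.

    - Contraction ([theta_flow_contraction]).  For nu >= 1 the matrix A strictly
      decreases a quadratic form, whatever theta in [1/2, 1].  Two chains driven
      by the same noise therefore merge, and there is at most one invariant
      measure ([contraction_unique_invariant]).

    - The Markov property ([markov_property]), derived from the independence of
      the increments by a product-measure argument.  It reduces invariance to one
      step ([one_step_invariant_measure]).

    - For theta = 1/2, invariance of the isotropic Gaussian
      ([midpoint_one_step_invariant]).  It rests on the rotation invariance of
      products of centred normal laws ([gauss_rotation]), itself obtained by
      writing a linear map of determinant one as three shears, each of which
      preserves Lebesgue measure by Fubini and translation invariance.  The large
      deviation principle is then elementary: a small box for the lower bound, an
      exponential Chebyshev inequality for the upper bound.

    - For theta > 1/2, a tail estimate.  The Laplace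
      transform of the chain is bounded by that of the Gaussian with covariance
      Sigma, by induction on time ([theta_laplace]); contraction passes the bound
      to any invariant measure ([theta_invariant_tail]), and a Chernoff bound
      forces an infinite rate at (1, 0) ([theta_invariant_rate_infinite]). *)

(** * Borel sets of the plane *)

Section plane_borel.
Context {R : realType}.

(** The measurable structure of the plane is the product one, so an open set is
    exhibited as a countable union of rational boxes. *)
Lemma open_measurable_plane (U : set (R * R)) : open U -> measurable U.
Proof.
move=> oU.
pose box (i : (rat * rat) * (rat * rat)) : set (R * R) :=
  `]ratr i.1.1, ratr i.1.2[%classic `*` `]ratr i.2.1, ratr i.2.2[%classic.
have -> : U = \bigcup_i (if `[< box i `<=` U >] then box i else set0).
  apply/seteqP; split => [x Ux|x [i _]]; last by case: asboolP => // /[apply].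
  have [e /= e0 eU] : exists2 e : R, 0 < e & ball x e `<=` U.
    by apply/nbhs_ballP; exact: open_nbhs_nbhs.
  have H (y : R) : exists i : rat * rat,
      [/\ y - e < ratr i.1, ratr i.1 < y, y < ratr i.2 & ratr i.2 < y + e].
    have [|a] := @rat_in_itvoo R (y - e) y; first lra.
    have [|b] := @rat_in_itvoo R y (y + e); first lra.
    by rewrite !in_itv/= => /andP[? ?] /andP[? ?]; exists (a, b).
  have [i [i1 i2 i3 i4]] := H x.1; have [j [j1 j2 j3 j4]] := H x.2.
  exists (i, j) => //; case: asboolP => [_|nb].
    by rewrite /box /= !in_itv/= i2 i3 j2 j3.
  case: nb => z [/=]; rewrite !in_itv/= => /andP[z1 z2] /andP[z3 z4].
  by apply: eU; split => /=; rewrite /ball/= ltr_distlC; apply/andP; split; lra.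
apply: countable_bigcupT_measurable => // i.
by case: asboolP => // _; exact: measurableX.
Qed.

Lemma continuous_measurable_plane (f : R * R -> R) :
  continuous f -> measurable_fun setT f.
Proof.
move=> cf; apply: (measurability _ (RGenOpens.measurableE R)).
move=> _ [_ [a [b ->]] <-]; rewrite setTI.
by apply: open_measurable_plane; apply: open_comp => // x _; exact: cf.
Qed.

End plane_borel.

(** * Densities, push-forwards and products of measures *)

Section density.
Import HBNNSimple.

(** The identity holds for indicators by definition of the density, and extends
    by linearity and monotone convergence. *)
Lemma ge0_integral_density (d : measure_display) (T : measurableType d)
    (R : realType) (m mu : {measure set T -> \bar R}) (g : T -> R) :
  measurable_fun setT g -> (forall x, 0 <= g x) ->
  (forall A, measurable A -> m A = (\int[mu]_(x in A) (g x)%:E)%E) ->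
  forall f : T -> \bar R, measurable_fun setT f -> (forall x, 0 <= f x)%E ->
  (\int[m]_x f x = \int[mu]_x (f x * (g x)%:E))%E.
Proof.
move=> mg g0 mE f mf f0.
have Hind (E : set T) : measurable E ->
  (\int[m]_x (\1_E x)%:E = \int[mu]_x ((\1_E x)%:E * (g x)%:E))%E.
  move=> mE'; rewrite integral_indic// setIT mE// integral_mkcond/=.
  apply: eq_integral => x _; rewrite patchE indicE; case: ifPn => xE.
    by rewrite mul1e.
  by rewrite mul0e.
have Hsf (h : {nnsfun T >-> R}) :
   (\int[m]_x (h x)%:E = \int[mu]_x ((h x)%:E * (g x)%:E))%E.
  under [LHS]eq_integral do rewrite fimfunE -fsumEFin//.
  rewrite [LHS]ge0_integral_fsum//; last 2 first.
    - by move=> r; exact/measurable_EFinP/measurableT_comp.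
    - by move=> n x _; rewrite EFinM nnfun_muleindic_ge0.
  under [RHS]eq_integral.
    move=> x xD; rewrite fimfunE -fsumEFin// ge0_mule_fsuml; last first.
      by move=> r; rewrite EFinM nnfun_muleindic_ge0.
    over.
  rewrite [RHS]ge0_integral_fsum//; last 2 first.
    - move=> r; apply: emeasurable_funM; apply/measurable_EFinP => //.
      by apply/measurableT_comp.
    - by move=> n x _; apply: mule_ge0;
        [rewrite EFinM nnfun_muleindic_ge0 | rewrite lee_fin].
  apply: eq_fsbigr => r _.
  have mr : measurable (h @^-1` [set r]) by exact: measurable_funPTI.
  have [r0|r0] := leP 0 r; last first.
    rewrite preimage_nnfun0//.
    by transitivity (0%E : \bar R); [|symmetry]; apply: integral0_eq => x _;
      rewrite indic0 mulr0 ?mul0e.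
  under eq_integral do rewrite EFinM.
  rewrite ge0_integralZl//; last 1 first.
  - exact/measurable_EFinP/measurable_indic.
  rewrite Hind// -ge0_integralZl//.
  - by apply: eq_integral => x _; rewrite EFinM muleA.
  - apply: emeasurable_funM; apply/measurable_EFinP => //.
  - by move=> x _; rewrite mule_ge0// lee_fin.
pose f_ := nnsfun_approx measurableT mf.
transitivity (lim (\int[m]_x (f_ n x)%:E @[n --> \oo])%E).
  rewrite -monotone_convergence//=.
  - apply: eq_integral => ? /[!inE] xD; apply/esym/cvg_lim => //=.
    exact: cvg_nnsfun_approx.
  - by move=> n; exact/measurable_EFinP/measurable_funTS.
  - by move=> n ? _; rewrite lee_fin.
  - by move=> ? _ ? ? mn; rewrite lee_fin; exact/lefP/nd_nnsfun_approx.
under eq_fun do rewrite Hsf.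
rewrite -monotone_convergence//=.
- apply: eq_integral => x /[!inE] xD; apply/cvg_lim => //=.
  apply: cvgeZr; first by [].
  exact: cvg_nnsfun_approx.
- move=> n; apply: emeasurable_funM; apply/measurable_EFinP => //.
- by move=> n ? _; rewrite mule_ge0// lee_fin.
- move=> ? _ ? ? mn; rewrite lee_wpmul2r ?lee_fin//; exact/lefP/nd_nnsfun_approx.
Qed.

End density.

(** The measure structure of a push-forward depends on a proof of measurability,
    which is made an argument here. *)
Definition image_measure {d1 d2 : measure_display} {T1 : measurableType d1}
    {T2 : measurableType d2} {R : realType} (m : {measure set T1 -> \bar R})
    (f : T1 -> T2) (mf : measurable_fun setT f) : {measure set T2 -> \bar R} :=
  measure_function_pushforward__canonical__measure_function_Measure m mf.

(** Measurable rectangles form a generating family stable under intersection. *)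
Lemma eq_measure_rectangles (d1 d2 : measure_display) (T1 : measurableType d1)
    (T2 : measurableType d2) (R : realType)
    (m1 m2 : {measure set (T1 * T2) -> \bar R}) :
  (forall A B, measurable A -> measurable B -> m1 (A `*` B) = m2 (A `*` B)) ->
  (m1 setT < +oo)%E ->
  forall C : set (T1 * T2), measurable C -> m1 C = m2 C.
Proof.
move=> m12 m1fin C mC.
pose G : set (set (T1 * T2)) :=
  [set X | exists A, measurable A /\ exists B, measurable B /\ X = A `*` B].
apply: (@measure_unique _ R (T1 * T2)%type G (fun=> setT)) => //.
- rewrite measurable_prod_measurableType //; congr (<<s _ >>).
  rewrite predeqE; split => [[A mA [B mB <-]]|[A [mA [B [mB ->]]]]].
    by exists A; split => //; exists B.
  by exists A => //; exists B.
- move=> /= _ _ [X1 [mX1 [X2 [mX2 ->]]]] [Y1 [mY1 [Y2 [mY2 ->]]]].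
  rewrite -setXI; exists (X1 `&` Y1); split; first exact: measurableI.
  by exists (X2 `&` Y2); split => //; exact: measurableI.
- by move=> _; exists setT; split => //; exists setT; rewrite setXTT.
- by rewrite bigcup_const.
- by move=> _ [A [mA [B [mB ->]]]]; exact: m12.
Qed.

(** * Normal laws on the line *)

Section gaussian.
Context {R : realType}.

(** Lebesgue measure and the centred normal law, carried by [R] with the Borel
    structure used for random variables and for products of reals. *)
Definition leb (A : set R) : \bar R := lebesgue_measure (A : set (measurableTypeR R)).

Let leb0 : leb set0 = 0%E.
Proof. exact: (@measure0 _ _ _ (@lebesgue_measure R)). Qed.
Let leb_ge0 A : (0 <= leb A)%E.
Proof. exact: (@measure_ge0 _ _ _ (@lebesgue_measure R)). Qed.
Let leb_add : semi_sigma_additive leb.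
Proof. exact: (@measure_semi_sigma_additive _ _ _ (@lebesgue_measure R)). Qed.
HB.instance Definition _ := isMeasure.Build _ R R leb leb0 leb_ge0 leb_add.
Let leb_sf : sigma_finite setT leb.
Proof. exact: (@sigma_finiteT _ _ _ (@lebesgue_measure R)). Qed.
HB.instance Definition _ := Measure_isSigmaFinite.Build _ R R leb leb_sf.

Definition gauss (s : R) (A : set R) : \bar R := normal_prob 0 s A.
Let gauss0 s : gauss s set0 = 0%E.
Proof. exact: (@measure0 _ _ _ (@normal_prob R 0 s)). Qed.
Let gauss_ge0 s A : (0 <= gauss s A)%E.
Proof. exact: (@measure_ge0 _ _ _ (@normal_prob R 0 s)). Qed.
Let gauss_add s : semi_sigma_additive (gauss s).
Proof. exact: (@measure_semi_sigma_additive _ _ _ (@normal_prob R 0 s)). Qed.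
HB.instance Definition _ s := isMeasure.Build _ R R
  (gauss s) (gauss0 s) (gauss_ge0 s) (@gauss_add s).
Let gauss_setT s : gauss s setT = 1%E.
Proof. exact: (@probability_setT _ _ _ (@normal_prob R 0 s)). Qed.
HB.instance Definition _ s := Measure_isProbability.Build _ _ _ (gauss s) (gauss_setT s).

Lemma ge0_integral_leb (f : R -> \bar R) D : measurable D ->
  measurable_fun D f -> (forall x, 0 <= f x)%E ->
  (\int[lebesgue_measure]_(x in D) f x = \int[leb]_(x in D) f x)%E.
Proof.
move=> mD mf f0.
have mid : measurable_fun setT (idfun : measurableTypeR R -> R).
  by move=> _ A mA; rewrite setTI.
have f0D : {in D, forall y, (0 <= f y)%E} by move=> y _; exact: f0.
rewrite -[LHS](ge0_integral_pushforward mid (@lebesgue_measure R) mD mf f0D).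
exact: eq_measure_integral.
Qed.

Lemma gaussE s A : measurable A ->
  gauss s A = (\int[leb]_(x in A) (normal_pdf 0 s x)%:E)%E.
Proof.
move=> mA; rewrite /gauss /normal_prob ge0_integral_leb//.
  by apply/measurable_EFinP/measurable_funTS; exact: measurable_normal_pdf.
by move=> x; rewrite lee_fin normal_pdf_ge0.
Qed.

Lemma ge0_integral_gauss s (f : R -> \bar R) : measurable_fun setT f ->
  (forall x, 0 <= f x)%E ->
  (\int[gauss s]_x f x = \int[leb]_x (f x * (normal_pdf 0 s x)%:E))%E.
Proof.
move=> mf f0; apply: ge0_integral_density => //.
- exact: measurable_normal_pdf.
- by move=> x; exact: normal_pdf_ge0.
- exact: gaussE.
Qed.

(** Both sides are measures that agree on bounded intervals. *)
Lemma leb_shift c (A : set R) : measurable A ->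
  leb ((fun x => x + c) @^-1` A) = leb A.
Proof.
move=> mA.
have mc : measurable_fun (setT : set (measurableTypeR R))
    (fun x : measurableTypeR R => x + c : measurableTypeR R).
  have mcR : measurable_fun [set: R] (fun x : R => x + c).
    exact: measurable_funD.
  by move=> _ B mB; exact: mcR.
apply/esym; rewrite /leb.
transitivity (pushforward (@lebesgue_measure R)
  (fun x : measurableTypeR R => x + c : measurableTypeR R) A) => //.
apply: lebesgue_measure_unique => // _ [[a b]] _ <-.
have E : (fun x : R => x + c) @^-1` `]a, b] = `](a - c), (b - c)]%classic.
  by apply/seteqP; split => x /=; rewrite !in_itv/= ltrBlDr lerBrDr.
rewrite /pushforward [X in _ = lebesgue_measure X]E.
rewrite !lebesgue_measure_itv/= !lte_fin ltrD2r.
by case: ifP => // _; rewrite -!EFinD; congr (_%:E); ring.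
Qed.

Lemma integral_leb_shift c (f : R -> \bar R) : measurable_fun setT f ->
  (forall x, 0 <= f x)%E ->
  (\int[leb]_x f (x + c)%R = \int[leb]_x f x)%E.
Proof.
move=> mf f0.
have mc : measurable_fun (setT : set R) (fun x : R => x + c : R).
  exact: measurable_funD.
have f0T : {in setT, forall y, (0 <= f y)%E} by move=> y _; exact: f0.
rewrite -[LHS](ge0_integral_pushforward mc leb measurableT mf f0T).
by apply: eq_measure_integral => A mA _; rewrite -[RHS](leb_shift c).
Qed.
End gaussian.

(** * Linear maps preserving Gaussian measures *)

Section gaussian_plane.
Context {R : realType}.
Implicit Types (s t r b : R) (f g : R * R -> \bar R).

Lemma leb_shear_l t g : measurable_fun setT g -> (forall z, 0 <= g z)%E ->
  (\int[leb]_x \int[leb]_y g (x + t * y, y)%R = \int[leb]_x \int[leb]_y g (x, y))%E.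
Proof.
move=> mg g0.
have mS : measurable_fun setT (fun z : R * R => (z.1 + t * z.2, z.2)).
  apply/measurable_fun_pairP; split; last exact: measurable_snd.
  by apply: measurable_funD => //; exact: measurable_funM.
rewrite (fubini_tonelli (m1 := leb) (m2 := leb)
  (fun z => g (z.1 + t * z.2, z.2)%R))//=; last first.
  exact: (measurableT_comp mg mS).
rewrite [RHS](fubini_tonelli (m1 := leb) (m2 := leb) g)//=.
apply: eq_integral => y _.
rewrite (integral_leb_shift (t * y) (fun x => g (x, y)))//.
exact: (measurableT_comp mg (pair2_measurable _)).
Qed.

Lemma leb_shear_r t g : measurable_fun setT g -> (forall z, 0 <= g z)%E ->
  (\int[leb]_x \int[leb]_y g (x, y + t * x)%R = \int[leb]_x \int[leb]_y g (x, y))%E.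
Proof.
move=> mg g0; apply: eq_integral => x _.
rewrite (integral_leb_shift (t * x) (fun y => g (x, y)))//.
exact: (measurableT_comp mg (pair1_measurable _)).
Qed.

Lemma ge0_integral_gauss2 s t f : measurable_fun setT f -> (forall z, 0 <= f z)%E ->
  (\int[gauss s]_x \int[gauss t]_y f (x, y) =
   \int[leb]_x \int[leb]_y
     (f (x, y) * (normal_pdf 0 s x * normal_pdf 0 t y)%:E))%E.
Proof.
move=> mf f0.
have mfx x : measurable_fun setT (fun y => f (x, y)).
  exact: (measurableT_comp mf (pair1_measurable _)).
rewrite ge0_integral_gauss//; last 2 first.
- exact: (measurable_fun_fubini_tonelli_F (m2 := gauss t) f).
- by move=> x; apply: integral_ge0.
apply: eq_integral => x _.
rewrite ge0_integral_gauss// -ge0_integralZr//.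
- by apply: eq_integral => y _; rewrite -muleA -EFinM (mulrC (normal_pdf 0 t y)).
- apply: emeasurable_funM => //; apply/measurable_EFinP.
  exact: measurable_normal_pdf.
- by move=> y _; rewrite mule_ge0// lee_fin normal_pdf_ge0.
- by rewrite lee_fin normal_pdf_ge0.
Qed.

(** The map (x, y) |-> (r x + b y, r y - (b t^2 / s^2) x) has determinant one and
    preserves the quadratic form x^2 / s^2 + y^2 / t^2, hence the product of
    N(0, s^2) and N(0, t^2).  For s = t it is a rotation; in general it sends x and
    y to a combination of variance s^2 and a variable independent of it. *)
Lemma gauss_rotation s t r b f :
  s != 0 -> t != 0 -> b != 0 -> r ^+ 2 * s ^+ 2 + b ^+ 2 * t ^+ 2 = s ^+ 2 ->
  measurable_fun setT f -> (forall z, 0 <= f z)%E ->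
  (\int[gauss s]_x \int[gauss t]_y
     f (r * x + b * y, r * y - b * t ^+ 2 / s ^+ 2 * x)%R =
   \int[gauss s]_x \int[gauss t]_y f (x, y))%E.
Proof.
move=> s0 t0 b0 rb mf f0.
set c := b * t ^+ 2 / s ^+ 2.
(* the map is the product S L S of three shears, which needs c != 0 *)
have c0 : c != 0 by rewrite !mulf_neq0// ?invr_eq0 ?expf_neq0.
pose a := (1 - r) / c.
pose S (z : R * R) := (z.1 + a * z.2, z.2).
pose L (z : R * R) := (z.1, z.2 + - c * z.1).
have SLS x y : S (L (S (x, y))) = (r * x + b * y, r * y - c * x).
  rewrite /S /L /=; congr pair; last by rewrite /a; field.
  have rc : b * c = 1 - r ^+ 2.
    rewrite /c; apply: (mulIf (expf_neq0 2 s0)); rewrite mulrBl mul1r.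
    by rewrite -[X in _ = X - _]rb; field.
  have -> : b = (1 - r ^+ 2) / c by rewrite -rc mulfK.
  by rewrite /a; field.
have mS : measurable_fun setT S.
  apply/measurable_fun_pairP; split; last exact: measurable_snd.
  by apply: measurable_funD => //; exact: measurable_funM.
have mL : measurable_fun setT L.
  apply/measurable_fun_pairP; split; first exact: measurable_fst.
  by apply: measurable_funD => //; exact: measurable_funM.
pose p (z : R * R) := normal_pdf 0 s z.1 * normal_pdf 0 t z.2.
have mp : measurable_fun setT p.
  by apply: measurable_funM;
    [exact: (measurableT_comp (measurable_normal_pdf _ _) measurable_fst)
    |exact: (measurableT_comp (measurable_normal_pdf _ _) measurable_snd)].
have pS z : p (S (L (S z))) = p z.
  case: z => x y; rewrite SLS /p /= !normal_pdfE// /normal_fun.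
  rewrite [LHS]mulrACA [RHS]mulrACA -!expRD; congr (_ * expR _).
  (* both sides are the quadratic form x^2/s^2 + y^2/t^2 *)
  have r2 : r ^+ 2 = 1 - b ^+ 2 * t ^+ 2 / s ^+ 2.
    apply: (mulIf (expf_neq0 2 s0)); rewrite mulrBl mul1r divfK ?expf_neq0//.
    by rewrite -[X in _ = X - _]rb; ring.
  have E : (r * x + b * y) ^+ 2 / s ^+ 2 + (r * y - c * x) ^+ 2 / t ^+ 2 =
    x ^+ 2 / s ^+ 2 + y ^+ 2 / t ^+ 2.
    have -> : (r * x + b * y) ^+ 2 / s ^+ 2 + (r * y - c * x) ^+ 2 / t ^+ 2 =
      r ^+ 2 * (x ^+ 2 / s ^+ 2 + y ^+ 2 / t ^+ 2)
      + b ^+ 2 * (y ^+ 2 / s ^+ 2 + t ^+ 2 * x ^+ 2 / s ^+ 4).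
      by rewrite /c; field; rewrite s0 t0.
    by rewrite r2; field; rewrite s0 t0.
  have H u v : - (u - 0) ^+ 2 / (s ^+ 2 *+ 2) + - (v - 0) ^+ 2 / (t ^+ 2 *+ 2) =
     - (u ^+ 2 / s ^+ 2 + v ^+ 2 / t ^+ 2) / 2.
    by field; rewrite s0 t0.
  by rewrite !H E.
pose g z := (f z * (p z)%:E)%E.
have mg : measurable_fun setT g.
  by apply: emeasurable_funM => //; exact/measurable_EFinP.
have g0 z : (0 <= g z)%E.
  by rewrite mule_ge0// lee_fin mulr_ge0// normal_pdf_ge0.
pose h z := f (S (L (S z))).
have mh : measurable_fun setT h.
  exact: (measurableT_comp mf (measurableT_comp mS (measurableT_comp mL mS))).
have h0 z : (0 <= h z)%E by exact: f0.
transitivity (\int[gauss s]_x \int[gauss t]_y h (x, y))%E.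
  by apply: eq_integral => x _; apply: eq_integral => y _; rewrite /h SLS.
rewrite (ge0_integral_gauss2 s t h mh h0) (ge0_integral_gauss2 s t f mf f0).
pose gS z := g (S z); pose gSL z := gS (L z).
have mgS : measurable_fun setT gS by exact: (measurableT_comp mg mS).
have mgSL : measurable_fun setT gSL by exact: (measurableT_comp mgS mL).
transitivity (\int[leb]_x \int[leb]_y gSL (x + a * y, y)%R)%E.
  apply: eq_integral => x _; apply: eq_integral => y _.
  by have := pS (x, y); rewrite [RHS]/p /= => <-.
transitivity (\int[leb]_x \int[leb]_y gSL (x, y))%E.
  by apply: leb_shear_l mgSL _ => z; exact: g0.
transitivity (\int[leb]_x \int[leb]_y gS (x, y + - c * x)%R)%E.
  by apply: eq_integral => x _; apply: eq_integral => y _.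
transitivity (\int[leb]_x \int[leb]_y gS (x, y))%E.
  by apply: leb_shear_r mgS _ => z; exact: g0.
transitivity (\int[leb]_x \int[leb]_y g (x + a * y, y)%R)%E.
  by apply: eq_integral => x _; apply: eq_integral => y _.
exact: leb_shear_l mg g0.
Qed.

End gaussian_plane.

(** * Exponential moments and small intervals *)

Section gaussian_moments.
Context {R : realType}.
Implicit Types s l a x delta : R.

Lemma integral_leb_normal_pdf m s : (\int[leb]_x (normal_pdf m s x)%:E = 1)%E.
Proof.
rewrite -ge0_integral_leb//; first exact: integral_normal_pdf.
- by apply/measurable_EFinP; exact: measurable_normal_pdf.
- by move=> x; rewrite lee_fin normal_pdf_ge0.
Qed.

(** Completing the square turns the integrand into a multiple of the density of a
    normal law with mean l s^2. *)
Lemma gauss_mgf s l : s != 0 ->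
  (\int[gauss s]_x (expR (l * x))%:E = (expR (l ^+ 2 * s ^+ 2 / 2))%:E)%E.
Proof.
move=> s0.
rewrite ge0_integral_gauss//; last first.
  have ml : measurable_fun setT (fun x : R => l * x) by exact: measurable_funM.
  by apply/measurable_EFinP; exact: (measurableT_comp (@measurable_expR R) ml).
transitivity (\int[leb]_x ((expR (l ^+ 2 * s ^+ 2 / 2))%:E *
                           (normal_pdf (l * s ^+ 2) s x)%:E))%E.
  apply: eq_integral => x _; rewrite -!EFinM; congr EFin.
  rewrite !normal_pdfE// /normal_fun mulrCA [RHS]mulrCA -!expRD.
  by congr (_ * expR _); field.
rewrite ge0_integralZl//.
- by rewrite integral_leb_normal_pdf mule1.
- by apply/measurable_EFinP; exact: measurable_normal_pdf.
- by move=> x _; rewrite lee_fin normal_pdf_ge0.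
Qed.

(** The integrand is 1 / a times the density of the normal law with standard
    deviation s / a. *)
Lemma gauss_expR_sqr s a : s != 0 -> 0 < a ->
  (\int[gauss s]_x (expR ((1 - a ^+ 2) * x ^+ 2 / (s ^+ 2 *+ 2)))%:E = a^-1%:E)%E.
Proof.
move=> s0 a0; have an0 := lt0r_neq0 a0.
have sa0 : s / a != 0 by rewrite mulf_neq0// invr_eq0.
rewrite ge0_integral_gauss//; last first.
  have mq : measurable_fun setT
      (fun x : R => (1 - a ^+ 2) * x ^+ 2 / (s ^+ 2 *+ 2)).
    by do 2 apply: measurable_funM => //; exact: exprn_measurable.
  by apply/measurable_EFinP; exact: (measurableT_comp (@measurable_expR R) mq).
transitivity (\int[leb]_x (a^-1%:E * (normal_pdf 0 (s / a) x)%:E))%E.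
  apply: eq_integral => x _; rewrite -!EFinM; congr EFin.
  rewrite !normal_pdfE// /normal_fun [LHS]mulrCA -expRD [RHS]mulrA; congr (_ * expR _).
    rewrite /normal_peak -invfM; congr (_^-1).
    have -> : s ^+ 2 * pi *+ 2 = a ^+ 2 * ((s / a) ^+ 2 * pi *+ 2) by field.
    by rewrite sqrtrM ?sqr_ge0// sqrtr_sqr gtr0_norm.
  by field; rewrite an0.
rewrite ge0_integralZl//.
- by rewrite integral_leb_normal_pdf mule1.
- by apply/measurable_EFinP; exact: measurable_normal_pdf.
- by move=> x _; rewrite lee_fin normal_pdf_ge0.
- by rewrite lee_fin invr_ge0 ltW.
Qed.

(** The length of the interval times the least value of the density on it. *)
Lemma gauss_itv_ge s x delta : s != 0 -> 0 < delta ->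
  ((2 * delta * normal_peak s *
    expR (- (`|x| + delta) ^+ 2 / (s ^+ 2 *+ 2)))%:E
   <= gauss s `](x - delta)%R, (x + delta)%R[%classic)%E.
Proof.
move=> s0 d0; rewrite gaussE//.
have E : leb `](x - delta), (x + delta)[%classic = (2 * delta)%:E.
  rewrite /leb lebesgue_measure_itv/= lte_fin ifT; last lra.
  by rewrite -EFinD; congr EFin; ring.
rewrite -mulrA EFinM -E muleC -integral_cst//.
apply: ge0_le_integral => //.
- by move=> y _; rewrite lee_fin mulr_ge0// ?normal_peak_ge0// expR_ge0.
- by apply/measurable_EFinP/measurable_funTS; exact: measurable_normal_pdf.
- move=> y /=; rewrite in_itv/= => /andP[y1 y2].
  rewrite lee_fin normal_pdfE// ler_wpM2l ?normal_peak_ge0// ler_expR.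
  rewrite !mulNr lerN2 subr0 ler_wpM2r//.
    by rewrite invr_ge0 mulrn_wge0// sqr_ge0.
  rewrite -[y ^+ 2]real_normK ?num_real// lerXn2r ?nnegrE ?addr_ge0 ?normr_ge0 ?(ltW d0)//.
  have : `|y - x| < delta by rewrite ltr_distl y1 y2.
  have := ler_normD (y - x) x; rewrite subrK => n1 n2; lra.
Qed.

End gaussian_moments.

(** * Gaussian images under a 2 x 3 matrix *)

Section gaussian_linear_image.
Context {R : realType}.

(** The three scalar hypotheses say s^2 A A^T + t^2 b b^T = s^2: the image of
    N(0, s^2) x N(0, s^2) x N(0, t^2) under the 2 x 3 matrix (A, b) has covariance
    s^2.  Three applications of [gauss_rotation] triangularize the matrix and
    identify the image itself.  The conditions a12, b1, b2 != 0 keep every rotation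
    away from the identity, where the decomposition into shears degenerates. *)
Lemma gauss_linear_image (s t a11 a12 a21 a22 b1 b2 : R)
    (f : R * R -> \bar R) :
  s != 0 -> t != 0 -> a12 != 0 -> b1 != 0 -> b2 != 0 ->
  s ^+ 2 * (a11 ^+ 2 + a12 ^+ 2) + t ^+ 2 * b1 ^+ 2 = s ^+ 2 ->
  s ^+ 2 * (a21 ^+ 2 + a22 ^+ 2) + t ^+ 2 * b2 ^+ 2 = s ^+ 2 ->
  s ^+ 2 * (a11 * a21 + a12 * a22) + t ^+ 2 * (b1 * b2) = 0 ->
  measurable_fun setT f -> (forall x, 0 <= f x)%E ->
  (\int[gauss s]_p \int[gauss s]_q \int[gauss t]_z
     f (a11 * p + a12 * q + b1 * z, a21 * p + a22 * q + b2 * z)%R =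
   \int[gauss s]_p \int[gauss s]_q f (p, q))%E.
Proof.
move=> s0 t0 a120 b10 b20 c11 c22 c12 mf f0.
have aa0 : 0 < a11 ^+ 2 + a12 ^+ 2.
  by rewrite ltr_wpDl ?sqr_ge0// exprn_even_gt0.
(* c1, c2 are the coefficients of the second row after the first rotation, and k
   those of the noise after the second *)
pose r := Num.sqrt (a11 ^+ 2 + a12 ^+ 2).
have r2 : r ^+ 2 = a11 ^+ 2 + a12 ^+ 2 by rewrite sqr_sqrtr// ltW.
have r0 : r != 0 by rewrite gt_eqF// sqrtr_gt0.
have s20 : s ^+ 2 != 0 by rewrite expf_neq0.
pose c1 := (a21 * a11 + a22 * a12) / r.
pose c2 := (a22 * a11 - a21 * a12) / r.
pose k := b2 / r.
have k0 : k != 0 by rewrite mulf_neq0 ?invr_eq0.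
have c1E : c1 = - (k * (b1 * t ^+ 2 / s ^+ 2)).
  apply: (mulIf s20); apply: (mulIf r0); rewrite /c1 /k.
  have H : s ^+ 2 * (a11 * a21 + a12 * a22) = - (t ^+ 2 * (b1 * b2)).
    by apply/eqP; rewrite -addr_eq0 c12.
  transitivity (s ^+ 2 * (a11 * a21 + a12 * a22)); first by field.
  by rewrite H; field; rewrite r0 s0.
have r2s : r ^+ 2 = 1 - t ^+ 2 * b1 ^+ 2 / s ^+ 2.
  apply: (mulIf s20); rewrite mulrBl mul1r divfK// -[X in _ = X - _]c11 -r2.
  by ring.
have c2E : c2 ^+ 2 * s ^+ 2 + k ^+ 2 * t ^+ 2 = s ^+ 2.
  have -> : c2 ^+ 2 = a21 ^+ 2 + a22 ^+ 2 - c1 ^+ 2.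
    rewrite /c1 /c2 !exprMn exprVn r2.
    by field; exact: lt0r_neq0.
  rewrite c1E -[RHS]c22.
  have -> : t ^+ 2 * b2 ^+ 2 = t ^+ 2 * k ^+ 2 * r ^+ 2.
    by rewrite /k; field.
  by rewrite r2s; field.
have mlin (x1 x2 x3 y1 y2 y3 : R) : measurable_fun setT
    (fun u : (R * R) * R => f (x1 * u.1.1 + x2 * u.1.2 + x3 * u.2,
                               y1 * u.1.1 + y2 * u.1.2 + y3 * u.2)).
  have m11 : measurable_fun setT (fun u : (R * R) * R => u.1.1).
    exact: (measurableT_comp measurable_fst measurable_fst).
  have m12 : measurable_fun setT (fun u : (R * R) * R => u.1.2).
    exact: (measurableT_comp measurable_snd measurable_fst).
  have m2 : measurable_fun setT (fun u : (R * R) * R => u.2).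
    exact: measurable_snd.
  apply: (measurableT_comp mf); apply: measurable_fun_pair;
    by apply: measurable_funD; [apply: measurable_funD|]; apply: measurable_funM.
have mint (x1 x2 x3 y1 y2 y3 tau : R) : measurable_fun setT
    (fun u : R * R => \int[gauss tau]_z f (x1 * u.1 + x2 * u.2 + x3 * z,
                               y1 * u.1 + y2 * u.2 + y3 * z)%R)%E.
  apply: (measurable_fun_fubini_tonelli_F (m2 := gauss tau)
    (fun u : (R * R) * R => f (x1 * u.1.1 + x2 * u.1.2 + x3 * u.2,
                               y1 * u.1.1 + y2 * u.1.2 + y3 * u.2))) => //.
(* rotate (p, q) so that only p enters the first coordinate *)
pose g (u : R * R) := (\int[gauss t]_z
   f (r * u.1 + 0 * u.2 + b1 * z, c1 * u.1 + c2 * u.2 + b2 * z)%R)%E.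
have mg : measurable_fun setT g by exact: mint.
have g0 u : (0 <= g u)%E by apply: integral_ge0.
transitivity (\int[gauss s]_p \int[gauss s]_q g (p, q))%E.
  have rot : (a11 / r) ^+ 2 * s ^+ 2 + (a12 / r) ^+ 2 * s ^+ 2 = s ^+ 2.
    by rewrite -mulrDl !exprMn -mulrDl -r2 exprVn divff ?mul1r ?expf_neq0.
  transitivity (\int[gauss s]_p \int[gauss s]_q
    g (a11 / r * p + a12 / r * q, a11 / r * q - a12 / r * s ^+ 2 / s ^+ 2 * p)%R)%E;
    last first.
    by apply: gauss_rotation => //; rewrite mulf_neq0 ?invr_eq0.
  apply: eq_integral => p _; apply: eq_integral => q _; apply: eq_integral => z _.
  congr (f (_, _)) => /=; first by field; rewrite r0 s0.
  congr (_ + _); apply: (mulIf (expf_neq0 2 r0)); rewrite {1}r2 /c1 /c2.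
  by field; rewrite r0 s0.
(* in the plane of p and the noise, rotate to the first coordinate and a
   variable independent of it *)
transitivity (\int[gauss s]_q \int[gauss s]_p \int[gauss t]_z
    f (p, c2 * q + k * z)%R)%E.
  transitivity (\int[gauss s]_q \int[gauss s]_p g (p, q))%E.
    exact: (fubini_tonelli (m1 := gauss s) (m2 := gauss s) g).
  apply: eq_integral => q _.
  pose fq (u : R * R) := f (u.1, c2 * q + k * u.2).
  have mfq : measurable_fun setT fq.
    apply: (measurableT_comp mf); apply: measurable_fun_pair => //.
    by apply: measurable_funD => //; apply: measurable_funM.
  transitivity (\int[gauss s]_p \int[gauss t]_z
    fq (r * p + b1 * z, r * z - b1 * t ^+ 2 / s ^+ 2 * p)%R)%E; last first.
    apply: gauss_rotation => //; last by move=> u; exact: f0.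
    by rewrite -[RHS]c11 r2; ring.
  apply: eq_integral => p _; apply: eq_integral => z _.
  congr (f (_, _)) => /=; first by ring.
  by rewrite c1E /k; field; rewrite r0 s0.
transitivity (\int[gauss s]_p \int[gauss s]_q \int[gauss t]_z
    f (p, c2 * q + k * z)%R)%E.
  pose g2 (u : R * R) := (\int[gauss t]_z f (u.1, c2 * u.2 + k * z)%R)%E.
  have mg2 : measurable_fun setT g2.
    apply: (measurable_fun_fubini_tonelli_F (m2 := gauss t)
      (fun u : (R * R) * R => f (u.1.1, c2 * u.1.2 + k * u.2))) => //.
    have := mlin 1 0 0 0 c2 k; congr (measurable_fun _ _).
    by apply/funext => u; rewrite !mul0r !mul1r !addr0 add0r.
  have g20 u : (0 <= g2 u)%E by apply: integral_ge0.
  exact/esym/(fubini_tonelli (m1 := gauss s) (m2 := gauss s) g2).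
(* c2 q + k z has the law of q, again by a rotation *)
apply: eq_integral => p _.
have mfp : measurable_fun setT (fun u : R * R => f (p, u.1)).
  exact: (measurableT_comp (measurableT_comp mf (pair1_measurable p)) measurable_fst).
transitivity (\int[gauss s]_q \int[gauss t]_z (fun u : R * R => f (p, u.1)) (q, z))%E.
  exact: (gauss_rotation s t c2 k (fun u => f (p, u.1)) s0 t0 k0 c2E mfp
    (fun u => f0 _)).
apply: eq_integral => q _.
by rewrite /= integral_cst// [X in (_ * X)%E]probability_setT mule1.
Qed.

End gaussian_linear_image.

(** * Markov chains driven by independent noise *)

Section markov_chain.
Context {R : realType} {d : measure_display} {Omega : measurableType d}.
Variable P : probability Omega R.
Context {dT : measure_display} {T : measurableType dT}.
Variables (F : T * R -> T) (xi : nat -> {RV P >-> R}) (gamma : probability R R).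
Hypothesis mF : measurable_fun setT F.
Hypothesis indep : forall n, independent_RVs P (fun i : 'I_n => xi i).
Hypothesis law : forall n B, measurable B -> P (xi n @^-1` B) = gamma B.

Fixpoint markov_chain (x : T) (n : nat) (omega : Omega) : T :=
  if n is n'.+1 then F (markov_chain x n' omega, xi n' omega) else x.

Lemma measurable_markov_chain2 n :
  measurable_fun setT (fun z : T * Omega => markov_chain z.1 n z.2).
Proof.
elim: n => [|n IH]; first exact: measurable_fst.
apply: (measurableT_comp mF); apply: measurable_fun_pair => //.
exact: (measurableT_comp (measurable_funPT (xi n)) measurable_snd).
Qed.

Lemma measurable_markov_chain x n : measurable_fun setT (markov_chain x n).
Proof.
exact: (measurableT_comp (measurable_markov_chain2 n) (pair1_measurable x)).
Qed.

Let future n N (B : nat -> set R) : set Omega :=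
  [set omega | forall i, (n <= i < N)%N -> B i (xi i omega)].

Let measurable_future n N B : (forall i, measurable (B i)) ->
  measurable (future n N B).
Proof.
move=> mB.
have -> : future n N B = \bigcap_(i in [set i | (n <= i < N)%N]) (xi i @^-1` B i).
  by apply/seteqP; split => w /= H i; exact: H.
by apply: bigcap_measurableType => i _; exact: measurable_funPTI.
Qed.

(** The present state is independent of the future noise.  Keeping the whole
    future in the statement makes the induction on n self-contained: as functions
    of the set in which the pair (state, noise at time n) lies, the two sides are
    finite measures on a product space, and the induction hypothesis says that they
    agree on rectangles. *)
Lemma markov_chain_independent x n N (B : nat -> set R) (E : set T) :
  (forall i, measurable (B i)) -> measurable E ->
  (P (markov_chain x n @^-1` E `&` future n N B) =
   P (markov_chain x n @^-1` E) * \prod_(n <= i < N) gamma (B i))%E.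
Proof.
elim: n N B E => [|n IH] N B E mB mE.
  have [xE|xE] := pselect (E x); last first.
    rewrite (_ : markov_chain x 0 @^-1` E = set0) ?set0I ?measure0 ?mul0e//.
    by apply/seteqP; split.
  rewrite (_ : markov_chain x 0 @^-1` E = setT); last by apply/seteqP; split.
  rewrite setTI probability_setT mul1e.
  rewrite (_ : future 0 N B = \bigcap_(i in [set: 'I_N]) (xi i @^-1` B i)); last first.
    apply/seteqP; split => w /= H i; first by move=> _; apply: H; rewrite /= ltn_ord.
    by move=> /= iN; exact: (H (Ordinal iN) I).
  rewrite (indep N (fun i => B i)) // big_mkord.
  by apply: eq_bigr => i _; rewrite law.
have [Nn|nN] := leqP N n.+1.
  rewrite big_geq// mule1 (_ : future n.+1 N B = setT) ?setIT//.
  apply/seteqP; split => // w _ i /andP[ni iN].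
  by have := leq_ltn_trans ni (leq_trans iN Nn); rewrite ltnn.
pose Y w := (markov_chain x n w, xi n w).
have mY : measurable_fun setT Y.
  by apply: measurable_fun_pair => //; exact: measurable_markov_chain.
have mfut : measurable (future n.+1 N B) by exact: measurable_future.
pose c := (\prod_(n.+1 <= i < N) gamma (B i))%E.
have c0 : (0 <= c)%E by apply: prode_ge0 => i _; exact: measure_ge0.
have cfin : c \is a fin_num.
  by apply: prode_fin_num => i _; exact: fin_num_measure.
have c0' : 0 <= fine c by exact: fine_ge0.
pose m1 : {measure set (T * R) -> \bar R} := image_measure (mrestr P mfut) _ mY.
pose m2 : {measure set (T * R) -> \bar R} :=
  mscale (NngNum c0') (image_measure P _ mY).
suff H : m1 (F @^-1` E) = m2 (F @^-1` E).
  by rewrite -/c -(fineK cfin) muleC; exact: H.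
apply: eq_measure_rectangles.
- move=> A D mA mD.
  (* on rectangles, the noise at time n becomes part of the future *)
  pose B' i := if i == n then D else B i.
  have mB' i : measurable (B' i) by rewrite /B'; case: ifP.
  suff : (P (Y @^-1` (A `*` D) `&` future n.+1 N B) =
          c * P (Y @^-1` (A `*` D)))%E.
    by rewrite -(fineK cfin).
  have -> : Y @^-1` (A `*` D) = markov_chain x n @^-1` A `&` future n n.+1 B'.
    apply/seteqP; split => w /= [Aw H]; split => //.
      move=> i; rewrite ltnS -eqn_leq => /eqP <-; rewrite /B' eqxx.
      exact: H.
    by have := H n; rewrite /B' eqxx; apply; rewrite leqnn ltnSn.
  rewrite (IH n.+1)// big_nat1 -setIA.
  have -> : future n n.+1 B' `&` future n.+1 N B = future n N B'.
    apply/seteqP; split => w /=.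
      move=> [H1 H2] i /andP[]; rewrite leq_eqVlt => /predU1P[<- _|ni iN].
        by apply: H1; rewrite leqnn ltnSn.
      by rewrite /B' gtn_eqF//; apply: H2; rewrite ni.
    move=> H; split => i /andP[ni iN].
      by apply: H; rewrite ni (leq_trans iN)// ltnW.
    by have := H i; rewrite /B' gtn_eqF//; apply; rewrite (ltnW ni).
  rewrite (IH N)// big_ltn 1?ltnW// [B' n]/B' eqxx [RHS]muleCA.
  congr (_ * _)%E; rewrite [RHS]muleC; congr (_ * _)%E.
  by apply: eq_big_nat => i /andP[ni _]; rewrite /B' gtn_eqF.
- apply: (@le_lt_trans _ _ 1%E); last by rewrite ltry.
  apply: probability_le1; apply: measurableI => //.
  by rewrite -[X in measurable X]setTI; apply: (mY).
- by rewrite -[X in measurable X]setTI; exact: mF.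
Qed.

Lemma markov_property x n (phi : T -> \bar R) :
  measurable_fun setT phi -> (forall y, 0 <= phi y)%E ->
  (\int[P]_w phi (markov_chain x n.+1 w) =
   \int[P]_w \int[gamma]_z phi (F (markov_chain x n w, z)))%E.
Proof.
move=> mphi phi0.
pose X : {mfun Omega >-> T} := HB.pack (markov_chain x n)
  (isMeasurableFun.Build _ _ _ _ _ (measurable_markov_chain x n)).
pose Y w := (markov_chain x n w, xi n w).
have mY : measurable_fun setT Y.
  by apply: measurable_fun_pair => //; exact: measurable_markov_chain.
pose Y' : {mfun Omega >-> (T * R)%type} := HB.pack Y
  (isMeasurableFun.Build _ _ _ _ _ mY).
have mphiF : measurable_fun setT (phi \o F) by exact: measurableT_comp.
transitivity (\int[distribution P Y']_y (phi \o F) y)%E.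
  by rewrite ge0_integral_distribution//= => y; exact: phi0.
transitivity (\int[distribution P X \x gamma]_y (phi \o F) y)%E.
  apply: eq_measure_integral => D mD _; apply/esym.
  apply: product_measure_unique => // A B mA mB.
  pose B' (i : nat) := B.
  have := @markov_chain_independent x n n.+1 B' A (fun=> mB) mA.
  rewrite big_nat1 /= => <-; congr (P _).
  apply/seteqP; split => w /= [Aw H]; split => //.
    by move=> i; rewrite ltnS -eqn_leq => /eqP <-.
  by apply: H; rewrite leqnn ltnSn.
rewrite fubini_tonelli1//=.
rewrite ge0_integral_distribution//=; last first.
- by move=> y; apply: integral_ge0 => z _; exact: phi0.
- apply: (measurable_fun_fubini_tonelli_F (m2 := gamma) (phi \o F)) => // y.
  exact: phi0.
Qed.

End markov_chain.

(** * Measures determined by quadrants *)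

Section plane_quadrants.
Context {R : realType}.

Lemma eq_measure_rays (m1 m2 : {measure set R -> \bar R}) :
  (forall a, m1 `]-oo, a[%classic = m2 `]-oo, a[%classic) ->
  (m1 setT < +oo)%E -> forall A : set R, measurable A -> m1 A = m2 A.
Proof.
move=> m12 m1fin A mA.
apply: (@measure_unique _ R R (@RGenInftyO.G R) (fun n => `]-oo, n%:R[%classic)) => //.
- exact: RGenInftyO.measurableE.
- move=> _ _ [a ->] [b ->]; exists (Num.min a b).
  by apply/seteqP; split => x /=; rewrite !in_itv/= lt_min; [case=> -> -> | move/andP].
- by move=> n; exists n%:R.
- apply/seteqP; split => // x _; exists (Num.trunc x).+1 => //=.
  by rewrite in_itv/= truncnS_gt.
- by move=> B [a ->].
- by move=> k; apply: le_lt_trans m1fin; apply: le_measure; rewrite ?inE.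
Qed.

(** Extending one factor at a time reduces the claim to measures on the line that
    agree on rays. *)
Lemma eq_probability_quadrants (m m' : probability (R * R)%type R) :
  (forall a b, m (`]-oo, a[ `*` `]-oo, b[) = m' (`]-oo, a[ `*` `]-oo, b[)) ->
  forall A : set (R * R), measurable A -> m A = m' A.
Proof.
move=> mm'.
have mX (A B : set R) : measurable A -> measurable B -> measurable (A `*` B).
  exact: measurableX.
pose slice1 (mu : probability (R * R)%type R) (B : set R) (mB : measurable B)
    : {measure set R -> \bar R} :=
  image_measure (mrestr mu (mX setT B measurableT mB)) _
    (measurable_fst : measurable_fun [set: R * R] fst).
pose slice2 (mu : probability (R * R)%type R) (A : set R) (mA : measurable A)
    : {measure set R -> \bar R} :=
  image_measure (mrestr mu (mX A setT mA measurableT)) _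
    (measurable_snd : measurable_fun [set: R * R] snd).
have slice1E mu B (mB : measurable B) A : slice1 mu B mB A = mu (A `*` B).
  by congr (mu _); apply/seteqP; split => -[x y] /= [] // ? [].
have slice2E mu A (mA : measurable A) B : slice2 mu A mA B = mu (A `*` B).
  by congr (mu _); apply/seteqP; split => -[x y] /= [] // ? [].
have fin mu C : measurable C -> ((mu : probability (R * R)%type R) C < +oo)%E.
  by move=> mC; apply: le_lt_trans (probability_le1 _ mC) _; rewrite ltry.
have H1 A b : measurable A -> m (A `*` `]-oo, b[) = m' (A `*` `]-oo, b[).
  move=> mA; have mb : measurable (`]-oo, b[%classic : set R) by [].
  rewrite -!(slice1E _ _ mb); apply: eq_measure_rays => //.
    by move=> a; rewrite !slice1E.
  by rewrite slice1E; apply: fin; exact: measurableX.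
have H2 A B : measurable A -> measurable B -> m (A `*` B) = m' (A `*` B).
  move=> mA mB; rewrite -!(slice2E _ _ mA); apply: eq_measure_rays => //.
    by move=> a; rewrite !slice2E H1.
  by rewrite slice2E; apply: fin; exact: measurableX.
by move=> A mA; apply: eq_measure_rectangles => //; exact: fin.
Qed.

(** Lipschitz functions that increase with k >= 0 to the indicator of the quadrant
    x.1 < a, x.2 < b.  They are the test functions that determine an invariant
    measure. *)
Definition quadrant_ramp (k a b : R) (x : R * R) : R :=
  Num.min 1 (Num.max 0 (Num.min (k * (a - x.1)) (k * (b - x.2)))).

Lemma quadrant_ramp_ge0 k a b x : 0 <= quadrant_ramp k a b x.
Proof. by rewrite le_min ler01 le_max lexx. Qed.

Lemma quadrant_ramp_le1 k a b x : quadrant_ramp k a b x <= 1.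
Proof. by rewrite ge_min lexx. Qed.

Lemma quadrant_ramp_lip k a b x y : 0 <= k ->
  quadrant_ramp k a b y <=
  quadrant_ramp k a b x + k * (`|x.1 - y.1| + `|x.2 - y.2|).
Proof.
move=> k0; rewrite /quadrant_ramp.
have H (u v c : R) : k * (c - v) <= k * (c - u) + k * `|u - v|.
  by rewrite -mulrDr ler_wpM2l//; have := ler_norm (u - v); lra.
have := H x.1 y.1 a; have := H x.2 y.2 b.
have := mulr_ge0 k0 (normr_ge0 (x.1 - y.1)).
have := mulr_ge0 k0 (normr_ge0 (x.2 - y.2)).
rewrite [k * (_ + `|_|)]mulrDr.
set e1 := k * `|x.1 - y.1|; set e2 := k * `|x.2 - y.2|.
move: e1 e2 (k * (a - x.1)) (k * (b - x.2)) (k * (a - y.1)) (k * (b - y.2)).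
move=> e1 e2 u1 u2 v1 v2 e20 e10 h2 h1.
have : Num.min v1 v2 <= Num.min u1 u2 + (e1 + e2).
  by case: (leP u1 u2) => ?; case: (leP v1 v2) => ?; lra.
move: (Num.min u1 u2) (Num.min v1 v2) => u v uv.
case: (leP 0 u) => ?; case: (leP 0 v) => ?;
  rewrite ?[Num.min 1 0]minEle ?ler10/=.
- by case: (leP 1 u) => ?; case: (leP 1 v) => ?; lra.
- by case: (leP 1 u) => ?; lra.
- by case: (leP 1 v) => ?; lra.
- by lra.
Qed.

Lemma continuous_quadrant_ramp k a b : continuous (quadrant_ramp k a b).
Proof.
move=> x.
have c0 (c : R) : {for x, continuous (fun=> c : R^o)} by exact: cst_continuous.
have c1 : {for x, continuous (fun x => k * (a - x.1) : R^o)}.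
  apply: cvgM; first exact: cvg_cst.
  by apply: cvgB; [exact: cvg_cst|exact: cvg_fst].
have c2 : {for x, continuous (fun x => k * (b - x.2) : R^o)}.
  apply: cvgM; first exact: cvg_cst.
  by apply: cvgB; [exact: cvg_cst|exact: cvg_snd].
exact: (continuous_min (c0 1) (continuous_max (c0 0) (continuous_min c1 c2))).
Qed.

Lemma quadrant_ramp_cvg a b x :
  quadrant_ramp n%:R a b x @[n --> \oo] --> (\1_(`]-oo, a[ `*` `]-oo, b[) x : R).
Proof.
rewrite indicE; have [|xn] := boolP (x \in _).
  rewrite inE /= !in_itv/= => -[xa xb].
  (* the ramp is 1 as soon as n * min (a - x.1) (b - x.2) >= 1 *)
  have c0 : 0 < Num.min (a - x.1) (b - x.2) by rewrite lt_min !subr_gt0 xa xb.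
  apply: cvg_near_cst; near=> n.
  have n1 : 1 <= n%:R * Num.min (a - x.1) (b - x.2).
    rewrite -ler_pdivrMr// mul1r; near: n; exact: nbhs_infty_ger.
  rewrite /quadrant_ramp -minr_pMr// ?ler0n//.
  by apply/eqP; rewrite eq_le ge_min lexx/= le_min lexx le_max n1 orbT.
apply: cvg_near_cst; apply: nearW => n; apply/eqP.
rewrite /quadrant_ramp -minr_pMr ?ler0n//.
have c0 : Num.min (a - x.1) (b - x.2) <= 0.
  move: xn; rewrite notin_setE/= !in_itv/= => /not_andP xn.
  by rewrite ge_min !subr_le0; apply/orP; case: xn => /negP;
    rewrite -leNgt => ?; [left|right].
rewrite eq_le ge_min ge_max lexx/= mulr_ge0_le0 ?ler0n// orbT/=.
by rewrite le_min ler01 le_max lexx.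
Unshelve. all: by end_near. Qed.
End plane_quadrants.

(** * Existence and uniqueness of invariant measures *)

Section invariance.
Context {R : realType} {d : measure_display} {Omega : measurableType d}.
Variable P : probability Omega R.
Variables (F : (R * R) * R -> R * R) (xi : nat -> {RV P >-> R}).
Variable gamma : probability R R.
Hypothesis mF : measurable_fun setT F.
Hypothesis indep : forall n, independent_RVs P (fun i : 'I_n => xi i).
Hypothesis law : forall n B, measurable B -> P (xi n @^-1` B) = gamma B.
Local Notation X := (markov_chain P F xi).

(** Induction on n: by the Markov property, n + 1 steps integrate phi as n steps
    integrate its image under the transition operator. *)
Lemma one_step_invariant_iter (m : probability (R * R)%type R) :
  (forall phi : R * R -> \bar R, measurable_fun setT phi ->
     (forall y, 0 <= phi y)%E ->
     (\int[m]_x \int[gamma]_z phi (F (x, z)) = \int[m]_x phi x)%E) ->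
  forall n (phi : R * R -> \bar R), measurable_fun setT phi ->
     (forall y, 0 <= phi y)%E ->
     (\int[m]_x \int[P]_w phi (X x n w) = \int[m]_x phi x)%E.
Proof.
move=> inv; elim=> [|n IH] phi mphi phi0.
  apply: eq_integral => x _ /=.
  by rewrite integral_cst//= probability_setT mule1.
have mphiF : measurable_fun setT (phi \o F) by exact: measurableT_comp.
have phiF0 z : (0 <= (phi \o F) z)%E by exact: phi0.
under eq_integral do rewrite (markov_property P F xi gamma)//.
rewrite (IH (fun y => \int[gamma]_z phi (F (y, z)))%E); first exact: inv.
- exact: (measurable_fun_fubini_tonelli_F (m2 := gamma) (phi \o F) mphiF phiF0).
- by move=> y; exact: integral_ge0.
Qed.

(** [one_step_invariant_iter] applied to indicators says that the chain started
    from m has law m at all times; bounded test functions follow by integration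
    against that law. *)
Lemma one_step_invariant_measure (m : probability (R * R)%type R) :
  (forall phi : R * R -> \bar R, measurable_fun setT phi ->
     (forall y, 0 <= phi y)%E ->
     (\int[m]_x \int[gamma]_z phi (F (x, z)) = \int[m]_x phi x)%E) ->
  invariant_measure P X m.
Proof.
move=> /one_step_invariant_iter inv phi cphi [M [Mreal phiM]] n.
have mphi := continuous_measurable_plane _ cphi.
have mX : measurable_fun setT (fun z : (R * R) * Omega => X z.1 n z.2).
  exact: measurable_markov_chain2.
have intX : (m \x P)%E.-integrable setT (fun z => (phi (X z.1 n z.2))%:E).
  apply: (@measurable_bounded_integrable _ _ _ _ (fun z => phi (X z.1 n z.2))) => //.
  - rewrite [X in (X < _)%E](_ : _ = 1%E) ?ltry//; exact: (probability_setT (m \x P)%E).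
  - exact: (measurableT_comp mphi mX).
  - by exists M; split => // y My z _; exact: phiM.
transitivity (\int[m]_x \int[P]_w (phi (X x n w))%:E)%E.
  by apply: eq_integral => x _; rewrite unlock.
rewrite [LHS](integral12_prod_meas1 intX).
have mphiE : measurable_fun setT (EFin \o phi) by exact/measurable_EFinP.
transitivity (\int[pushforward (m \x P)%E
    (fun z : (R * R) * Omega => X z.1 n z.2)]_y (phi y)%:E)%E.
  by apply/esym; apply: (integral_pushforward mX mphiE).
apply: eq_measure_integral => A mA _.
have mA1 : measurable_fun setT (EFin \o (\1_A : R * R -> R)).
  exact/measurable_EFinP/measurable_indic.
have A0 z : (0 <= (EFin \o (\1_A : R * R -> R)) z)%E by rewrite lee_fin.
have := inv n _ mA1 A0; rewrite integral_indic// setIT => <-.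
have mXA : measurable ((fun z : (R * R) * Omega => X z.1 n z.2) @^-1` A).
  by rewrite -[X in measurable X]setTI; exact: mX.
transitivity (\int[m \x P]_z
    (\1_((fun z : (R * R) * Omega => X z.1 n z.2) @^-1` A) z)%:E)%E.
  by rewrite integral_indic// setIT.
rewrite fubini_tonelli1//.
exact/measurable_EFinP/measurable_indic.
Qed.

Hypothesis contraction : exists C r : R, [/\ 0 <= C, 0 <= r < 1 &
  forall x n w, `|(X x n w).1 - (X 0 n w).1| + `|(X x n w).2 - (X 0 n w).2|
                <= C * r ^+ n * (`|x.1| + `|x.2|)].

(** Two chains driven by the same noise merge, so an invariant integral of a
    Lipschitz function is asymptotically the expectation along the chain
    started at the origin, whatever the invariant measure. *)
Lemma invariant_integral_cvg (m : probability (R * R)%type R) k a b :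
  0 <= k -> invariant_measure P X m ->
  exists delta : nat -> \bar R, [/\ delta n @[n --> \oo] --> 0%E,
    forall n, (\int[m]_x (quadrant_ramp k a b x)%:E <=
      \int[P]_w (quadrant_ramp k a b (X 0 n w))%:E + delta n)%E &
    forall n, (\int[P]_w (quadrant_ramp k a b (X 0 n w))%:E <=
      \int[m]_x (quadrant_ramp k a b x)%:E + delta n)%E].
Proof.
move=> k0 inv; have [C [r [C0 /andP[r0 r1] Hc]]] := contraction.
set phi := quadrant_ramp k a b.
have cphi : continuous phi by exact: continuous_quadrant_ramp.
have mphi := continuous_measurable_plane _ cphi.
have phi01 x : 0 <= phi x <= 1.
  by rewrite quadrant_ramp_ge0 quadrant_ramp_le1.
have bphi : bounded_fun phi.
  exists 1; split => // y y1 z _; have /andP[p0 p1] := phi01 z.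
  by rewrite /= ger0_norm// (le_trans p1)// ltW.
have mX n : measurable_fun setT (fun z : (R * R) * Omega => X z.1 n z.2).
  exact: measurable_markov_chain2.
have mXx x n : measurable_fun setT (X x n) by exact: measurable_markov_chain.
(* the cap at 1 provides an integrable bound *)
pose rho n (x : R * R) := Num.min 1 (k * (C * r ^+ n * (`|x.1| + `|x.2|))).
have rho0 n x : 0 <= rho n x.
  by rewrite le_min ler01/= mulr_ge0// mulr_ge0// ?addr_ge0// mulr_ge0// exprn_ge0.
have mrho n : measurable_fun setT (rho n).
  apply: measurable_minr => //; do 2 apply: measurable_funM => //.
  by apply: measurable_funD; apply: measurableT_comp.
have phiX x n w : `|phi (X x n w) - phi (X 0 n w)| <= rho n x.
  have /andP[p0 p1] := phi01 (X x n w); have /andP[q0 q1] := phi01 (X 0 n w).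
  rewrite le_min; apply/andP; split; first by rewrite ler_norml; apply/andP; split; lra.
  have H := ler_wpM2l k0 (Hc x n w); apply: le_trans H.
  have := quadrant_ramp_lip k a b (X x n w) (X 0 n w) k0.
  have := quadrant_ramp_lip k a b (X 0 n w) (X x n w) k0.
  rewrite (distrC (X 0 n w).1) (distrC (X 0 n w).2) -!/phi => H1 H2.
  by rewrite ler_norml; apply/andP; split; lra.
pose e n x := (\int[P]_w (phi (X x n w))%:E)%E.
have me n : measurable_fun setT (e n).
  apply: (measurable_fun_fubini_tonelli_F (m2 := P)
    (fun z : (R * R) * Omega => (phi (X z.1 n z.2))%:E)).
  - by apply/measurable_EFinP; exact: (measurableT_comp mphi (mX n)).
  - by move=> z; rewrite lee_fin; have /andP[] := phi01 (X z.1 n z.2).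
have e0 n x : (0 <= e n x)%E.
  by apply: integral_ge0 => w _; rewrite lee_fin; have /andP[] := phi01 (X x n w).
have eint n : (\int[m]_x e n x = \int[m]_x (phi x)%:E)%E.
  by rewrite -(inv phi cphi bphi n); apply: eq_integral => x _; rewrite unlock.
have leD n x y c : 0 <= c -> (forall w, phi (X x n w) <= phi (X y n w) + c) ->
    (e n x <= e n y + c%:E)%E.
  move=> c0 cxy.
  have mpX z : measurable_fun setT (fun w => (phi (X z n w))%:E).
    by apply/measurable_EFinP; exact: (measurableT_comp mphi (mXx z n)).
  have -> : (e n y + c%:E = \int[P]_w ((phi (X y n w))%:E + c%:E))%E.
    rewrite ge0_integralD//.
      by rewrite integral_cst// [X in (_ * X)%E]probability_setT mule1.
    by move=> w _; rewrite lee_fin; have /andP[] := phi01 (X y n w).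
  apply: ge0_le_integral => //.
  - by move=> w _; rewrite lee_fin; have /andP[] := phi01 (X x n w).
  - by apply: emeasurable_funD.
  - by move=> w _; rewrite -EFinD lee_fin; exact: cxy.
have e1 n x : (e n x <= e n 0%R + (rho n x)%:E)%E.
  by apply: leD => // w; have := phiX x n w; rewrite ler_norml => /andP[]; lra.
have e2 n x : (e n 0%R <= e n x + (rho n x)%:E)%E.
  by apply: leD => // w; have := phiX x n w; rewrite ler_norml => /andP[]; lra.
have mrhoE n : measurable_fun setT (EFin \o rho n) by exact/measurable_EFinP.
exists (fun n => \int[m]_x (rho n x)%:E)%E; split.
- rewrite [X in _ --> X](_ : _ = \int[m]_x (cst 0 x))%E; last by rewrite integral0.
  apply: (@dominated_cvg _ _ _ m setT measurableT _ _ (cst 1%E)) => //.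
  + move=> x _; apply: cvg_EFin; first by apply: nearW.
    have H : k * (C * r ^+ n * (`|x.1| + `|x.2|)) @[n --> \oo] --> (0 : R).
      have -> : (0 : R) = k * (C * 0 * (`|x.1| + `|x.2|)) by ring.
      apply: cvgM; first exact: cvg_cst.
      apply: cvgM; last exact: cvg_cst.
      apply: cvgM; first exact: cvg_cst.
      by apply: cvg_expr; rewrite ger0_norm.
    apply: (squeeze_cvgr _ (cvg_cst 0) H); apply: nearW => n.
    by rewrite rho0/= ge_min lexx orbT.
  + exact: (finite_measure_integrable_cst m 1).
  + by move=> n x _; rewrite /= lee_fin ger0_norm// ge_min lexx.
- move=> n; rewrite -(eint n) -/(e n 0).
  have -> : (e n 0%R + \int[m]_x (rho n x)%:E = \int[m]_x (e n 0%R + (rho n x)%:E))%E.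
    rewrite ge0_integralD//.
    + by rewrite integral_cst// [X in (_ * X)%E]probability_setT mule1.
    + by move=> x _; rewrite lee_fin.
    + exact: mrhoE.
  by apply: ge0_le_integral => //; apply: emeasurable_funD => //; exact: mrhoE.
- move=> n; rewrite -(eint n) -/(e n 0).
  rewrite -ge0_integralD//; [|by move=> x _; rewrite lee_fin|exact: mrhoE].
  rewrite -[leLHS]mule1 -(probability_setT m) -integral_cst//.
  apply: ge0_le_integral => //.
  + by move=> x _; exact: e0.
  + by apply: emeasurable_funD => //; exact: mrhoE.
  + by move=> x _; exact: e2.
Qed.

(** The integrals of the ramps under two invariant measures are limits of the same
    sequence; letting the ramps increase gives the masses of quadrants. *)
Lemma contraction_unique_invariant (m m' : probability (R * R)%type R) :
  invariant_measure P X m -> invariant_measure P X m' ->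
  forall A : set (R * R), measurable A -> m' A = m A.
Proof.
have le_int (m1 m2 : probability (R * R)%type R) k a b : 0 <= k ->
    invariant_measure P X m1 -> invariant_measure P X m2 ->
    (\int[m1]_x (quadrant_ramp k a b x)%:E <=
     \int[m2]_x (quadrant_ramp k a b x)%:E)%E.
  move=> k0 i1 i2.
  have [d1 [d10 h1 _]] := invariant_integral_cvg _ _ a b k0 i1.
  have [d2 [d20 _ h2]] := invariant_integral_cvg _ _ a b k0 i2.
  have H n : (\int[m1]_x (quadrant_ramp k a b x)%:E <=
     \int[m2]_x (quadrant_ramp k a b x)%:E + (d2 n + d1 n))%E.
    by rewrite addeA; apply: le_trans (h1 n) _; rewrite leeD2r.
  have K : (\int[m2]_x (quadrant_ramp k a b x)%:E + (d2 n + d1 n))%E @[n --> \oo] -->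
     (\int[m2]_x (quadrant_ramp k a b x)%:E + (0 + 0))%E.
    apply: cvgeD; first by rewrite adde0 fin_num_adde_defl.
      exact: cvg_cst.
    by apply: cvgeD.
  move: K; rewrite !adde0 => K.
  by apply: cvge_ge K; near=> n; exact: H.
move=> im im' A mA; apply: eq_probability_quadrants mA => a b.
have mQ : measurable (`]-oo, a[ `*` `]-oo, b[ : set (R * R)) by exact: measurableX.
have lim (mu : probability (R * R)%type R) :
    (\int[mu]_x (quadrant_ramp n%:R a b x)%:E)%E @[n --> \oo] -->
    mu (`]-oo, a[ `*` `]-oo, b[).
  rewrite -[X in _ --> mu X]setIT -integral_indic//.
  apply: (@dominated_cvg _ _ _ mu setT measurableT _ _ (cst 1%E)) => //.
  - move=> n; apply/measurable_EFinP; apply: continuous_measurable_plane.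
    exact: continuous_quadrant_ramp.
  - move=> x _; apply: cvg_EFin; first by apply: nearW.
    exact: quadrant_ramp_cvg.
  - exact: (finite_measure_integrable_cst mu 1).
  - move=> n x _; rewrite /= lee_fin ger0_norm ?quadrant_ramp_ge0//.
    exact: quadrant_ramp_le1.
have E : (fun n => \int[m']_x (quadrant_ramp n%:R a b x)%:E)%E =
         (fun n => \int[m]_x (quadrant_ramp n%:R a b x)%:E)%E.
  by apply/funext => n; apply/eqP; rewrite eq_le !le_int// ler0n.
by have := lim m'; rewrite E => L; exact: (cvg_unique _ L (lim m)).
Unshelve. all: by end_near. Qed.

End invariance.

(** * Dynamics of the theta-method *)

Section theta_dynamics.
Context {R : realType}.
Variables (theta nu h epsilon : R).
Hypotheses (theta_ge : 2^-1 <= theta) (theta_le : theta <= 1).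
Hypotheses (nu_ge1 : 1 <= nu) (h_gt0 : 0 < h) (epsilon_gt0 : 0 < epsilon).

Definition theta_step (u : (R * R) * R) : R * R :=
  let D := 1 + theta_delta theta nu h in
  (((1 - (theta * h ^+ 2 + nu * h) * (1 - theta)) * u.1.1 - h * u.1.2
     + Num.sqrt epsilon * u.2) / D,
   (h * u.1.1 + (1 - theta * (1 - theta) * h ^+ 2 + nu * theta * h) * u.1.2
     + Num.sqrt epsilon * u.2 * (theta * h)) / D).

Definition increments {d} {Omega : measurableType d} {P : probability Omega R}
  (W : R -> {RV P >-> R}) (n : nat) : {RV P >-> R} :=
  W (n.+1%:R * h) - W (n%:R * h).

Lemma theta_chainE d (Omega : measurableType d) (P : probability Omega R)
    (W : R -> {RV P >-> R}) :
  theta_chain theta nu h epsilon W = markov_chain P theta_step (increments W).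
Proof.
apply/funext => x; apply/funext => n; apply/funext => w.
elim: n => [//|n IH].
transitivity (theta_step (markov_chain P theta_step (increments W) x n w,
    W (n.+1%:R * h) w - W (n%:R * h) w)); last by [].
rewrite [LHS]/= IH.
move: (markov_chain _ _ _ _ _ _) (_ - _) => c z.
rewrite /pair_of_col /theta_A /theta_b !mxE /= !big_ord_recl !big_ord0 !mxE /=.
by rewrite /theta_step /=; congr pair; ring.
Qed.

Lemma measurable_theta_step : measurable_fun setT theta_step.
Proof.
have m11 : measurable_fun setT (fun u : (R * R) * R => u.1.1).
  exact: (measurableT_comp measurable_fst measurable_fst).
have m12 : measurable_fun setT (fun u : (R * R) * R => u.1.2).
  exact: (measurableT_comp measurable_snd measurable_fst).
have m2 : measurable_fun setT (fun u : (R * R) * R => u.2).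
  exact: measurable_snd.
apply: measurable_fun_pair; apply: measurable_funM => //;
  apply: measurable_funD; try (by repeat apply: measurable_funM).
- by apply: measurable_funB; apply: measurable_funM.
- by apply: measurable_funD; apply: measurable_funM.
Qed.

Let theta_gt0 : 0 < theta. Proof. by move: theta_ge; lra. Qed.
Let nu_gt0 : 0 < nu. Proof. by move: nu_ge1; lra. Qed.

Lemma theta_delta_ge0 : 0 <= theta_delta theta nu h.
Proof.
by rewrite /theta_delta mulr_ge0 ?ltW// addr_gt0// ?mulr_gt0// exprn_gt0.
Qed.

Let D_neq0 : 1 + theta_delta theta nu h != 0.
Proof. by rewrite gt_eqF// ltr_pwDl// theta_delta_ge0. Qed.

Definition theta_flow (n : nat) (x : R * R) : R * R :=
  iter n (fun y => theta_step (y, 0)) x.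

Lemma markov_chain_theta_flow d (Omega : measurableType d)
    (P : probability Omega R) (xi : nat -> {RV P >-> R}) x n w :
  markov_chain P theta_step xi x n w =
    ((theta_flow n x).1 + (markov_chain P theta_step xi 0 n w).1,
     (theta_flow n x).2 + (markov_chain P theta_step xi 0 n w).2).
Proof.
elim: n => [|n IH] /=; first by case: x => a b; rewrite !addr0.
by rewrite IH {1 3}/theta_step /=; congr pair; field.
Qed.

(** The energy is dissipated only through the momentum.  The cross term, scaled by
    1 / nu so that the form stays definite, transfers part of the dissipation to
    the position. *)
Definition lyapunov (x : R * R) : R := x.1 ^+ 2 + x.2 ^+ 2 + x.1 * x.2 / nu.

Lemma lyapunov_bounds x :
  (x.1 ^+ 2 + x.2 ^+ 2) / 2 <= lyapunov x <= 3 / 2 * (x.1 ^+ 2 + x.2 ^+ 2).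
Proof.
rewrite /lyapunov; move: x => [a b] /=.
have inv1 : nu^-1 <= 1 by rewrite invf_le1.
have inv0 : 0 < nu^-1 by rewrite invr_gt0.
have ab1 : a * b / nu <= (a ^+ 2 + b ^+ 2) / 2.
  have := sqr_ge0 (a - b); have := sqr_ge0 (a + b).
  by move: inv1 inv0; move: nu^-1 => t; nra.
have ab2 : - ((a ^+ 2 + b ^+ 2) / 2) <= a * b / nu.
  have := sqr_ge0 (a - b); have := sqr_ge0 (a + b).
  by move: inv1 inv0; move: nu^-1 => t; nra.
by apply/andP; split; lra.
Qed.

(** With y = (1 - theta h M)^-1 x one has x = y - theta h M y and
    A x = y + (1 - theta) h M y.  The decrease of the quadratic form V is therefore
    - 2 h B(y, M y) + (2 theta - 1) h^2 V(M y), where B is the polar form of V: the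
    first term is coercive, the second is nonnegative as theta >= 1/2. *)
Lemma theta_step_lyapunov : exists rho : R, 0 <= rho < 1 /\
  forall x, lyapunov (theta_step (x, 0)) <= rho * lyapunov x.
Proof.
pose C := 2 * ((1 + h * nu) ^+ 2 + h ^+ 2 + 1).
have C0 : 0 < C.
  by rewrite /C mulr_gt0// ltr_wpDl// addr_ge0// ?sqr_ge0.
exists (1 - h / (6 * nu * C)); split.
  have Q0 : 0 < 6 * nu * C by rewrite mulr_gt0// mulr_gt0.
  rewrite ltrBlDr ltrDl divr_gt0// andbT subr_ge0 ler_pdivrMr// mul1r.
  have Ch : h <= C.
    rewrite /C; have := sqr_ge0 (h - 1); have := sqr_ge0 (1 + h * nu).
    have := h_gt0; nra.
  apply: le_trans Ch _; rewrite -[leLHS]mul1r ler_wpM2r ?ltW//.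
  by move: nu_ge1; lra.
move=> x; set D := 1 + theta_delta theta nu h.
pose y1 := (x.1 - theta * h * x.2) / D.
pose y2 := (theta * h * x.1 + (1 + theta * h * nu) * x.2) / D.
have x1E : x.1 = (1 + theta * h * nu) * y1 + theta * h * y2.
  by rewrite /y1 /y2 /D /theta_delta; field; exact: D_neq0.
have x2E : x.2 = y2 - theta * h * y1.
  by rewrite /y1 /y2 /D /theta_delta; field; exact: D_neq0.
have s1E : (theta_step (x, 0)).1 = y1 - (1 - theta) * h * (nu * y1 + y2).
  by rewrite /theta_step /= x1E x2E /theta_delta; field; exact: D_neq0.
have s2E : (theta_step (x, 0)).2 = y2 + (1 - theta) * h * y1.
  by rewrite /theta_step /= x1E x2E /theta_delta; field; exact: D_neq0.
(* M y = (- (nu y1 + y2), y1) *)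
have dissip : lyapunov x - lyapunov (theta_step (x, 0)) =
   h * ((2 * nu - nu^-1) * y1 ^+ 2 + y1 * y2 + y2 ^+ 2 / nu)
   + (2 * theta - 1) * h ^+ 2 * lyapunov (- (nu * y1 + y2), y1).
  rewrite /lyapunov s1E s2E x1E x2E /=; field; exact: lt0r_neq0.
have pos : 0 <= (2 * theta - 1) * h ^+ 2 * lyapunov (- (nu * y1 + y2), y1).
  have /andP[H _] := lyapunov_bounds (- (nu * y1 + y2), y1).
  apply: mulr_ge0; last by apply: le_trans H; rewrite divr_ge0// addr_ge0// sqr_ge0.
  by rewrite mulr_ge0 ?sqr_ge0//; move: theta_ge; lra.
have coer : (y1 ^+ 2 + y2 ^+ 2) / (4 * nu) <=
    (2 * nu - nu^-1) * y1 ^+ 2 + y1 * y2 + y2 ^+ 2 / nu.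
  rewrite -subr_ge0.
  have -> : (2 * nu - nu^-1) * y1 ^+ 2 + y1 * y2 + y2 ^+ 2 / nu -
    (y1 ^+ 2 + y2 ^+ 2) / (4 * nu) =
    ((2 * nu ^+ 2 - 5 / 4) * y1 ^+ 2 + nu * y1 * y2 + 3 / 4 * y2 ^+ 2) / nu.
    by field; exact: lt0r_neq0.
  apply: divr_ge0; last exact: ltW.
  have : 3 / 4 * nu ^+ 2 * y1 ^+ 2 <= (2 * nu ^+ 2 - 5 / 4) * y1 ^+ 2.
    by rewrite ler_wpM2r ?sqr_ge0//; move: nu_ge1; nra.
  have := sqr_ge0 (nu * y1 / 2 + y2).
  have := mulr_ge0 (sqr_ge0 nu) (sqr_ge0 y1); have := sqr_ge0 y2.
  nra.
have size : x.1 ^+ 2 + x.2 ^+ 2 <= C * (y1 ^+ 2 + y2 ^+ 2).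
  rewrite x1E x2E.
  have th : theta * h <= h by rewrite ler_piMl ?(ltW h_gt0).
  have thn : theta * h * nu <= h * nu by rewrite ler_wpM2r ?(ltW nu_gt0).
  have th0 : 0 <= theta * h := ltW (mulr_gt0 theta_gt0 h_gt0).
  have thn0 : 0 <= theta * h * nu := mulr_ge0 th0 (ltW nu_gt0).
  have p2 : (1 + theta * h * nu) ^+ 2 <= (1 + h * nu) ^+ 2.
    by apply: lerXn2r; rewrite ?nnegrE; lra.
  have q2 : (theta * h) ^+ 2 <= h ^+ 2.
    by apply: lerXn2r; rewrite ?nnegrE; lra.
  have := ler_wpM2r (sqr_ge0 y1) p2; have := ler_wpM2r (sqr_ge0 y2) q2.
  have := ler_wpM2r (sqr_ge0 y1) q2.
  have := sqr_ge0 ((1 + theta * h * nu) * y1 - theta * h * y2).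
  have := sqr_ge0 (y2 + theta * h * y1); have := sqr_ge0 y2.
  have := mulr_ge0 (sqr_ge0 (1 + h * nu)) (sqr_ge0 y2).
  rewrite /C; move: (theta * h) (1 + theta * h * nu) (1 + h * nu) => q p p'.
  have := sqr_ge0 y1; lra.
have /andP[_ up] := lyapunov_bounds x.
have step : h / (6 * nu * C) * lyapunov x <=
    h * ((y1 ^+ 2 + y2 ^+ 2) / (4 * nu)).
  have -> : h * ((y1 ^+ 2 + y2 ^+ 2) / (4 * nu)) =
      h / (6 * nu * C) * (3 / 2 * (C * (y1 ^+ 2 + y2 ^+ 2))).
    by have Cn := lt0r_neq0 C0; have nn := lt0r_neq0 nu_gt0; field; rewrite Cn nn.
  apply: ler_wpM2l.
    apply: divr_ge0; first exact: ltW.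
    by rewrite ltW// mulr_gt0// mulr_gt0.
  by apply: le_trans up _; rewrite ler_wpM2l.
have := ler_wpM2l (ltW h_gt0) coer.
move: step pos dissip; rewrite mulrBl mul1r; lra.
Qed.

(** The square root of the Lyapunov function is a norm, whence the rate
    [Num.sqrt rho]. *)
Lemma theta_flow_contraction : exists C r : R, [/\ 0 <= C, 0 <= r < 1 &
  forall x n, `|(theta_flow n x).1| + `|(theta_flow n x).2| <=
              C * r ^+ n * (`|x.1| + `|x.2|)].
Proof.
have [rho [/andP[rho0 rho1] rhoE]] := theta_step_lyapunov.
(* (|a| + |b|)^2 <= 2 (a^2 + b^2), and the bounds on V lose a factor 3: 6 <= 3^2 *)
exists 3, (Num.sqrt rho); split => // [|x n].
  by rewrite sqrtr_ge0/= -[ltRHS]sqrtr1 ltr_sqrt.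
have L : lyapunov (theta_flow n x) <= rho ^+ n * lyapunov x.
  elim: n => [|n IH]; first by rewrite expr0 mul1r.
  apply: le_trans (rhoE _) _; rewrite exprS -mulrA.
  exact: ler_wpM2l.
have /andP[lo _] := lyapunov_bounds (theta_flow n x).
have /andP[_ up] := lyapunov_bounds x.
have rn : 0 <= rho ^+ n by exact: exprn_ge0.
rewrite -ler_sqr ?nnegrE; last 2 first.
- by rewrite addr_ge0.
- by rewrite mulr_ge0 ?addr_ge0// mulr_ge0// exprn_ge0// sqrtr_ge0.
rewrite !exprMn -[_ ^+ n ^+ 2]exprM mulnC exprM sqr_sqrtr//.
have := ler_wpM2l rn up.
move: lo L; rewrite -!(real_normK (num_real (_.1))) -!(real_normK (num_real (_.2))).
move: (rho ^+ n) rn (lyapunov _) (lyapunov _) => t t0 v v0.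
have := mulr_ge0 (normr_ge0 x.1) (normr_ge0 x.2).
move: `|_| `|_| `|_| `|_| => a b c e ce.
have := sqr_ge0 (a - b); have := sqr_ge0 (c - e).
have := mulr_ge0 t0 ce; nra.
Qed.

Lemma theta_chain_contraction d (Omega : measurableType d)
    (P : probability Omega R) (xi : nat -> {RV P >-> R}) :
  exists C r : R, [/\ 0 <= C, 0 <= r < 1 & forall x n w,
    `|(markov_chain P theta_step xi x n w).1
      - (markov_chain P theta_step xi 0 n w).1| +
    `|(markov_chain P theta_step xi x n w).2
      - (markov_chain P theta_step xi 0 n w).2|
    <= C * r ^+ n * (`|x.1| + `|x.2|)].
Proof.
have [C [r [C0 r01 H]]] := theta_flow_contraction.
exists C, r; split => // x n w; rewrite markov_chain_theta_flow /= !addrK.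
exact: H.
Qed.

Lemma theta_flow_cvg0 x : (theta_flow n x).1 @[n --> \oo] --> (0 : R).
Proof.
have [C [r [C0 /andP[r0 r1] H]]] := theta_flow_contraction.
have K : C * r ^+ n * (`|x.1| + `|x.2|) @[n --> \oo] --> (0 : R).
  have -> : (0 : R) = C * 0 * (`|x.1| + `|x.2|) by ring.
  apply: cvgM; last exact: cvg_cst.
  apply: cvgM; first exact: cvg_cst.
  by apply: cvg_expr; rewrite ger0_norm.
apply: norm_cvg0; apply: (squeeze_cvgr _ (cvg_cst 0) K).
near=> n; rewrite normr_ge0/=; apply: le_trans (H x n).
by rewrite lerDl.
Unshelve. all: by end_near. Qed.

(** The transpose A^T, acting on linear functionals. *)
Definition theta_adjoint (l : R * R) : R * R :=
  let D := 1 + theta_delta theta nu h in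
  (((1 - (theta * h ^+ 2 + nu * h) * (1 - theta)) * l.1 + h * l.2) / D,
   (- h * l.1 + (1 - theta * (1 - theta) * h ^+ 2 + nu * theta * h) * l.2) / D).

(** The noise coefficient sqrt(epsilon) (b . l) of the functional l. *)
Definition theta_noise (l : R * R) : R :=
  Num.sqrt epsilon * (l.1 + theta * h * l.2) / (1 + theta_delta theta nu h).

Lemma theta_step_pairing l y z :
  l.1 * (theta_step (y, z)).1 + l.2 * (theta_step (y, z)).2 =
  (theta_adjoint l).1 * y.1 + (theta_adjoint l).2 * y.2 + theta_noise l * z.
Proof. by rewrite /theta_step /theta_adjoint /theta_noise /=; field. Qed.

(** The momentum variance of the solution Sigma of the covariance equation is
    epsilon / [theta_damping]: its (2, 2) entry gives Sigma_12 = k Sigma_11 / 2, its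
    (1, 2) entry Sigma_22 = (1 + k nu / 2 + k^2 / 2) Sigma_11, and the (1, 1) entry
    is then this value times Sigma_11 = epsilon. *)
Definition theta_damping : R :=
  let k := (2 * theta - 1) * h in
  2 * nu + 2 * k + k * nu ^+ 2 + 3 / 2 * k ^+ 2 * nu + k ^+ 3 / 2.

(** The variance l . Sigma l of the functional l. *)
Definition theta_covariance (l : R * R) : R :=
  let k := (2 * theta - 1) * h in
  epsilon / theta_damping *
  (l.1 ^+ 2 + k * l.1 * l.2 + (1 + k * nu / 2 + k ^+ 2 / 2) * l.2 ^+ 2).

Lemma theta_damping_ge : 2 * nu + (2 * theta - 1) * h * nu ^+ 2 <= theta_damping.
Proof.
have k0 : 0 <= (2 * theta - 1) * h.
  by rewrite mulr_ge0 ?(ltW h_gt0)//; move: theta_ge; lra.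
rewrite /theta_damping /=; move: ((2 * theta - 1) * h) k0 => k k0.
have := mulr_ge0 (sqr_ge0 k) (ltW nu_gt0); have := exprn_ge0 3 k0.
lra.
Qed.

(** The discrete Lyapunov equation Sigma = A Sigma A^T + epsilon h b b^T. *)
Lemma theta_covariance_stationary l :
  theta_covariance (theta_adjoint l) + theta_noise l ^+ 2 * h =
  theta_covariance l.
Proof.
have S0 : theta_damping != 0.
  apply: lt0r_neq0; apply: lt_le_trans theta_damping_ge.
  rewrite ltr_pwDl ?mulr_gt0// mulr_ge0 ?sqr_ge0// mulr_ge0 ?(ltW h_gt0)//.
  by move: theta_ge; lra.
rewrite /theta_covariance /theta_noise /theta_adjoint /=.
rewrite !exprMn sqr_sqrtr ?ltW//.
move: D_neq0 S0; rewrite /theta_damping /theta_delta => D0 S0.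
field; rewrite D0 andbT.
have two0 : (2 : R) != 0 by [].
by apply: contraNN S0 => /eqP E; apply/eqP; apply: (mulIf two0); rewrite mul0r -E; field.
Qed.

End theta_dynamics.

(** * Momentum tails of the invariant measures *)

Section theta_tails.
Context {R : realType} {d : measure_display} {Omega : measurableType d}.
Variable P : probability Omega R.
Variables (theta nu h epsilon : R).
Hypotheses (theta_ge : 2^-1 <= theta) (theta_le : theta <= 1).
Hypotheses (nu_ge1 : 1 <= nu) (h_gt0 : 0 < h) (epsilon_gt0 : 0 < epsilon).
Variable xi : nat -> {RV P >-> R}.
Hypothesis indep : forall n, independent_RVs P (fun i : 'I_n => xi i).
Hypothesis law : forall n B, measurable B ->
  P (xi n @^-1` B) = gauss (Num.sqrt h) B.
Local Notation X := (markov_chain P (theta_step theta nu h epsilon) xi).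
Local Notation flow := (theta_flow theta nu h epsilon).
Local Notation covariance := (theta_covariance theta nu h epsilon).

Lemma theta_covariance_ge0 l : 0 <= covariance l.
Proof.
have k0 : 0 <= (2 * theta - 1) * h.
  by rewrite mulr_ge0 ?(ltW h_gt0)//; move: theta_ge; lra.
have S0 : 0 < theta_damping theta nu h.
  apply: lt_le_trans (theta_damping_ge _ _ _ theta_ge nu_ge1 h_gt0).
  have nu0 : 0 < nu by move: nu_ge1; lra.
  by rewrite ltr_pwDl ?mulr_gt0// mulr_ge0 ?sqr_ge0.
rewrite /theta_covariance /= mulr_ge0 ?divr_ge0 ?(ltW epsilon_gt0) ?(ltW S0)//.
move: ((2 * theta - 1) * h) k0 => k k0.
have kn : 0 <= k * nu by rewrite mulr_ge0//; move: nu_ge1; lra.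
have := sqr_ge0 (l.1 + k / 2 * l.2); have := sqr_ge0 l.2.
have := mulr_ge0 kn (sqr_ge0 l.2); have := mulr_ge0 (sqr_ge0 k) (sqr_ge0 l.2).
nra.
Qed.

(** The right-hand side is the Laplace transform of the Gaussian with covariance
    Sigma centred at the noiseless trajectory.  One step replaces l by A^T l and
    multiplies by the Laplace transform of the noise, which is what the stationarity
    of Sigma absorbs. *)
Lemma theta_laplace n x l :
  (\int[P]_w (expR (l.1 * (X x n w).1 + l.2 * (X x n w).2))%:E <=
   (expR (l.1 * (flow n x).1 + l.2 * (flow n x).2 + covariance l / 2))%:E)%E.
Proof.
have mF := measurable_theta_step theta nu h epsilon.
have mexp (l' : R * R) : measurable_fun setT
    (fun y : R * R => (expR (l'.1 * y.1 + l'.2 * y.2))%:E).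
  have m1 : measurable_fun setT (fun y : R * R => l'.1 * y.1 + l'.2 * y.2).
    by apply: measurable_funD; apply: measurable_funM.
  by apply/measurable_EFinP; exact: (measurableT_comp (@measurable_expR R) m1).
elim: n l => [|n IH] l.
  rewrite /= integral_cst//= probability_setT mule1 lee_fin ler_expR lerDl.
  by rewrite divr_ge0 ?theta_covariance_ge0.
rewrite (@markov_property _ _ _ P _ _ (theta_step theta nu h epsilon) xi
  (gauss (Num.sqrt h)) mF indep law x n
  (fun y : R * R => (expR (l.1 * y.1 + l.2 * y.2))%:E) (mexp l)); last first.
  by move=> y; rewrite lee_fin expR_ge0.
pose l' := theta_adjoint theta nu h l; pose s := theta_noise theta nu h epsilon l.
have sh0 : Num.sqrt h != 0 by rewrite gt_eqF// sqrtr_gt0.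
have ms : measurable_fun setT (fun z : R => (expR (s * z))%:E).
  have m1 : measurable_fun setT (fun z : R => s * z) by exact: measurable_funM.
  by apply/measurable_EFinP; exact: (measurableT_comp (@measurable_expR R) m1).
have Gs : (\int[gauss (Num.sqrt h)]_z (expR (s * z))%:E =
           (expR (s ^+ 2 * h / 2))%:E)%E.
  by rewrite gauss_mgf// sqr_sqrtr ?(ltW h_gt0).
have E y : (\int[gauss (Num.sqrt h)]_z (expR (l.1 *
     (theta_step theta nu h epsilon (y, z)).1 +
     l.2 * (theta_step theta nu h epsilon (y, z)).2))%:E =
   (expR (l'.1 * y.1 + l'.2 * y.2))%:E * (expR (s ^+ 2 * h / 2))%:E)%E.
  transitivity (\int[gauss (Num.sqrt h)]_z
      ((expR (l'.1 * y.1 + l'.2 * y.2))%:E * (expR (s * z))%:E))%E.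
    by apply: eq_integral => z _; rewrite -EFinM -expRD; congr (expR _)%:E;
      exact: theta_step_pairing.
  rewrite ge0_integralZl//; last by rewrite Gs.
have -> : (\int[P]_w \int[gauss (Num.sqrt h)]_z (expR (l.1 *
     (theta_step theta nu h epsilon (X x n w, z)).1 +
     l.2 * (theta_step theta nu h epsilon (X x n w, z)).2))%:E =
   \int[P]_w ((expR (l'.1 * (X x n w).1 + l'.2 * (X x n w).2))%:E *
      (expR (s ^+ 2 * h / 2))%:E))%E.
  by apply: eq_integral => w _; exact: E.
rewrite ge0_integralZr//; last first.
  exact: (measurableT_comp (mexp l') (measurable_markov_chain P _ xi mF x n)).
apply: le_trans (lee_wpmul2r _ (IH l')) _; first by rewrite lee_fin expR_ge0.
rewrite -EFinM lee_fin -expRD ler_expR -addrA.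
have -> : covariance l' / 2 + s ^+ 2 * h / 2 = covariance l / 2.
  by rewrite -mulrDl theta_covariance_stationary.
rewrite lerD2r [flow n.+1 x]/= -/(flow n x) theta_step_pairing// mulr0 addr0.
exact: lexx.
Qed.

(** Chernoff's bound for the momentum.  The test function exp (l p) is truncated at
    its value K at p = c to be bounded; integrating it along the chain for a long
    time removes the initial condition, by contraction and dominated convergence. *)
Lemma theta_invariant_tail (m : probability (R * R)%type R) (l c : R) :
  0 <= l -> invariant_measure P X m ->
  (m [set x | (c < x.1)%R] <=
   (expR (covariance (l, 0) / 2 - l * c))%:E)%E.
Proof.
move=> l0 inv; have mF := measurable_theta_step theta nu h epsilon.
pose K := expR (l * c); have K0 : 0 < K by exact: expR_gt0.
pose phi (x : R * R) := Num.min K (expR (l * x.1)).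
have phi0 x : 0 <= phi x by rewrite le_min !expR_ge0.
have phiK x : phi x <= K by rewrite ge_min lexx.
have cphi : continuous phi.
  move=> x.
  have cK : {for x, continuous (fun=> K : R^o)} by exact: cst_continuous.
  have ce : {for x, continuous (fun y : R * R => expR (l * y.1) : R^o)}.
    apply: (cvg_comp (fun y : R * R => l * y.1) expR); last exact: continuous_expR.
    by apply: cvgM; [exact: cvg_cst|exact: cvg_fst].
  exact: (continuous_min cK ce).
have mphi := continuous_measurable_plane _ cphi.
have bphi : bounded_fun phi.
  exists K; split; [exact: num_real|move=> y Ky z _].
  by rewrite /= ger0_norm// (le_trans (phiK z))// ltW.
have mU : measurable [set x : R * R | c < x.1].
  rewrite (_ : [set _ | _] = fst @^-1` `]c, +oo[%classic); last first.
    by apply/seteqP; split => x /=; rewrite in_itv/= andbT.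
  by rewrite -[X in measurable X]setTI; exact: measurable_fst.
have KU : (K%:E * m [set x | (c < x.1)%R] <= \int[m]_x (phi x)%:E)%E.
  rewrite -[X in (_ * m X)%E]setIT -integral_indic// -ge0_integralZl//; last 2 first.
  - exact/measurable_EFinP/measurable_indic.
  - by rewrite lee_fin ltW.
  apply: ge0_le_integral => //.
  - by move=> x _; apply: mule_ge0; rewrite lee_fin//; exact: ltW.
  - by apply: measurable_funeM; exact/measurable_EFinP/measurable_indic.
  - by apply/measurable_EFinP.
  move=> x _; rewrite -EFinM lee_fin indicE; have [|_] := boolP (_ \in _);
    last by rewrite mulr0.
  rewrite inE /= mulr1 => cx; rewrite le_min lexx/= ler_expR.
  by rewrite ler_wpM2l// ltW.
pose q := covariance (l, 0) / 2.
pose g n x := Num.min K (expR (l * (flow n x).1 + q)).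
have g0 n x : 0 <= g n x by rewrite le_min !expR_ge0.
have mflow n : measurable_fun setT (flow n).
  elim: n => [|n IH]; first exact: measurable_id.
  exact: (measurableT_comp mF (measurableT_comp (pair2_measurable (0 : R)) IH)).
have mg n : measurable_fun setT (g n).
  apply: measurable_minr => //.
  have m1 : measurable_fun setT (fun x => l * (flow n x).1 + q).
    apply: measurable_funD => //; apply: measurable_funM => //.
    exact: (measurableT_comp measurable_fst (mflow n)).
  exact: (measurableT_comp (@measurable_expR R) m1).
have mX n : measurable_fun setT (fun z : (R * R) * Omega => X z.1 n z.2).
  exact: measurable_markov_chain2.
have mphiX n x : measurable_fun setT (fun w => (phi (X x n w))%:E).
  apply/measurable_EFinP.
  exact: (measurableT_comp mphi (measurable_markov_chain P _ xi mF x n)).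
have bound n : (\int[m]_x (phi x)%:E <= \int[m]_x (g n x)%:E)%E.
  rewrite -(inv phi cphi bphi n); apply: ge0_le_integral => //.
  - by move=> x _; apply: expectation_ge0 => w; exact: phi0.
  - rewrite unlock; apply: (measurable_fun_fubini_tonelli_F (m2 := P)
      (fun z : (R * R) * Omega => (phi (X z.1 n z.2))%:E)).
    + by apply/measurable_EFinP; exact: (measurableT_comp mphi (mX n)).
    + by move=> z; rewrite lee_fin.
  - by apply/measurable_EFinP.
  move=> x _; rewrite unlock /g EFin_min le_min; apply/andP; split.
    rewrite -[leRHS]mule1 -(probability_setT P) -integral_cst//.
    by apply: ge0_le_integral => // w _; rewrite lee_fin.
  have := theta_laplace n x (l, 0) => /=.
  rewrite [0 * _]mul0r addr0; apply: le_trans.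
  have mexp : measurable_fun setT (fun w => (expR (l * (X x n w).1))%:E).
    have m2 := measurable_markov_chain P _ xi mF x n.
    have m1 : measurable_fun setT (fun w => l * (X x n w).1).
      by apply: measurable_funM => //; exact: (measurableT_comp measurable_fst m2).
    by apply/measurable_EFinP; exact: (measurableT_comp (@measurable_expR R) m1).
  under [leRHS]eq_integral do rewrite mul0r addr0.
  apply: ge0_le_integral => //.
  - by move=> w _; rewrite lee_fin.
  by move=> w _; rewrite lee_fin /phi ge_min lexx orbT.
have lim : (\int[m]_x (g n x)%:E)%E @[n --> \oo] -->
    (\int[m]_x (cst (Num.min K (expR q))%:E x))%E.
  apply: (@dominated_cvg _ _ _ m setT measurableT _ _ (cst K%:E)) => //.
  - by move=> n; apply/measurable_EFinP.
  - move=> x _; apply: cvg_EFin; first by apply: nearW.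
    have E : l * (flow n x).1 + q @[n --> \oo] --> q.
      rewrite -[X in _ --> X]add0r -[X in _ --> X + _](mulr0 l).
      apply: cvgD; last exact: cvg_cst.
      by apply: cvgM; [exact: cvg_cst|exact: theta_flow_cvg0].
    have cK : {for q, continuous (fun=> K : R^o)} by exact: cst_continuous.
    have ce : {for q, continuous (expR : R -> R^o)} by exact: continuous_expR.
    exact: (cvg_comp _ _ E (continuous_min cK ce)).
  - exact: (finite_measure_integrable_cst m K).
  - by move=> n x _; rewrite /= lee_fin ger0_norm// ge_min lexx.
have H : (\int[m]_x (phi x)%:E <= (expR q)%:E)%E.
  apply: (@le_trans _ _ (\int[m]_x (cst (Num.min K (expR q))%:E x))%E).
    by apply: cvge_ge lim; near=> n; exact: bound.
  rewrite integral_cst// [X in (_ * X)%E]probability_setT mule1 lee_fin.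
  by rewrite ge_min lexx orbT.
rewrite expRD expRN -/K mulrC EFinM.
have -> : m [set x | (c < x.1)%R] =
    (K^-1%:E * (K%:E * m [set x | (c < x.1)%R]))%E.
  by rewrite muleA -EFinM mulVf ?gt_eqF// mul1e.
apply: lee_wpmul2l; first by rewrite lee_fin invr_ge0 ltW.
exact: le_trans KU H.
Unshelve. all: by end_near. Qed.

End theta_tails.

(** * The Gaussian invariant measure of the midpoint method *)

Section large_deviations.
Context {R : realType}.

Lemma limf_einf_ge (f : R -> \bar R) (c : \bar R) :
  (\forall nu \near +oo, (c <= f nu)%E) -> (c <= limf_einf f (pinfty_nbhs R))%E.
Proof.
move=> cf; rewrite limf_einfE; apply: le_ereal_sup_tmp.
exists (ereal_inf (f @` [set nu | (c <= f nu)%E]));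
  first by exists [set nu | (c <= f nu)%E].
by apply: le_ereal_inf_tmp => _ [nu ? <-].
Qed.

Lemma limf_einf_le (f : R -> \bar R) (c : \bar R) :
  (\forall nu \near +oo, (f nu <= c)%E) -> (limf_einf f (pinfty_nbhs R) <= c)%E.
Proof.
move=> fc; rewrite limf_einfE; apply: ge_ereal_sup => _ [V FV <-].
have [nu [Vnu fnu]] := filter_ex (filterI FV fc).
by apply: ge_ereal_inf; exists (f nu) => //; exists nu.
Qed.

Lemma limf_esup_le (f : R -> \bar R) (c : \bar R) :
  (\forall nu \near +oo, (f nu <= c)%E) -> (limf_esup f (pinfty_nbhs R) <= c)%E.
Proof.
move=> fc; rewrite limf_esupE; apply: ge_ereal_inf.
exists (ereal_sup (f @` [set nu | (f nu <= c)%E]));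
  first by exists [set nu | (f nu <= c)%E].
by apply: ge_ereal_sup => _ [nu ? <-].
Qed.

(** The density exp (- (nu / epsilon) (p^2 + q^2)) is that of two independent normal
    variables of variance epsilon / (2 nu). *)
Definition langevin_sd (epsilon nu : R) : R := Num.sqrt (epsilon / (2 * nu)).

Definition langevin_gauss (epsilon nu : R) : probability (R * R)%type R :=
  (gauss (langevin_sd epsilon nu) \x gauss (langevin_sd epsilon nu))%E.

Variable epsilon : R.
Hypothesis epsilon_gt0 : 0 < epsilon.
Local Notation sd := (langevin_sd epsilon).

Lemma langevin_sd_neq0 nu : 0 < nu -> sd nu != 0.
Proof. by move=> nu0; rewrite gt_eqF// sqrtr_gt0 divr_gt0// mulr_gt0. Qed.

Lemma langevin_sd_sqr nu : 0 < nu -> sd nu ^+ 2 = epsilon / (2 * nu).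
Proof. by move=> nu0; rewrite sqr_sqrtr// ltW// divr_gt0// mulr_gt0. Qed.

(** For theta = 1/2 the multiple epsilon / (2 nu) of the identity solves the
    covariance equation. *)
Lemma midpoint_one_step_invariant nu h (f : R * R -> \bar R) :
  0 < nu -> 0 < h -> measurable_fun setT f -> (forall x, 0 <= f x)%E ->
  (\int[langevin_gauss epsilon nu]_x \int[gauss (Num.sqrt h)]_z
      f (theta_step 2^-1 nu h epsilon (x, z)) =
   \int[langevin_gauss epsilon nu]_x f x)%E.
Proof.
move=> nu0 h0 mf f0.
have mstep := measurable_theta_step 2^-1 nu h epsilon.
have mint : measurable_fun setT (fun x => \int[gauss (Num.sqrt h)]_z
      f (theta_step 2^-1 nu h epsilon (x, z)))%E.
  apply: (measurable_fun_fubini_tonelli_F (m2 := gauss (Num.sqrt h))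
     (fun u => f (theta_step 2^-1 nu h epsilon u))) => //.
  exact: (measurableT_comp mf mstep).
rewrite /langevin_gauss fubini_tonelli1//=; last first.
  by move=> x; apply: integral_ge0.
rewrite [RHS]fubini_tonelli1//=.
pose D := 1 + theta_delta 2^-1 nu h.
have D0 : 0 < D.
  by rewrite /D /theta_delta; have := exprn_gt0 2 h0; have := mulr_gt0 nu0 h0; lra.
pose a11 := (1 - (2^-1 * h ^+ 2 + nu * h) * (1 - 2^-1)) / D.
pose a12 := - h / D.
pose a21 := h / D.
pose a22 := (1 - 2^-1 * (1 - 2^-1) * h ^+ 2 + nu * 2^-1 * h) / D.
pose b1 := Num.sqrt epsilon / D.
pose b2 := Num.sqrt epsilon * (2^-1 * h) / D.
have Dn := lt0r_neq0 D0.
have nun := lt0r_neq0 nu0.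
have e2 : Num.sqrt epsilon ^+ 2 = epsilon by rewrite sqr_sqrtr// ltW.
have t2 : Num.sqrt h ^+ 2 = h by rewrite sqr_sqrtr// ltW.
have se0 : Num.sqrt epsilon != 0 by rewrite gt_eqF// sqrtr_gt0.
have E4 : 4 + (h ^+ 2 + nu * h * 2) != 0.
  by rewrite gt_eqF//; have := exprn_gt0 2 h0; have := mulr_gt0 nu0 h0; lra.
transitivity (\int[gauss (sd nu)]_p \int[gauss (sd nu)]_q \int[gauss (Num.sqrt h)]_z
     f (a11 * p + a12 * q + b1 * z, a21 * p + a22 * q + b2 * z)%R)%E.
  apply: eq_integral => p _; apply: eq_integral => q _; apply: eq_integral => z _.
  congr (f (_, _)); rewrite /a11 /a12 /a21 /a22 /b1 /b2 /= -/D; field; exact: Dn.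
apply: gauss_linear_image => //.
- exact: langevin_sd_neq0.
- by rewrite gt_eqF// sqrtr_gt0.
- by rewrite mulf_neq0 ?invr_eq0// oppr_eq0 gt_eqF.
- by rewrite mulf_neq0 ?invr_eq0.
- by rewrite !mulf_neq0 ?invr_eq0// gt_eqF.
- rewrite t2 langevin_sd_sqr// /a11 /a12 /b1 !exprMn e2.
  by rewrite /D /theta_delta; field; rewrite nun E4.
- rewrite t2 langevin_sd_sqr// /a21 /a22 /b2 !exprMn e2.
  by rewrite /D /theta_delta; field; rewrite nun E4.
- have -> : b1 * b2 = epsilon * (2^-1 * h) / D ^+ 2.
    by rewrite /b1 /b2 -[in RHS]e2; field; exact: Dn.
  rewrite t2 langevin_sd_sqr// /a11 /a12 /a21 /a22.
  by rewrite /D /theta_delta; field; rewrite nun E4.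
Qed.

End large_deviations.

(** * Large deviations of the Gaussian invariant measure *)

Section gaussian_large_deviations.
Context {R : realType}.
Variable epsilon : R.
Hypothesis epsilon_gt0 : 0 < epsilon.
Local Notation sd := (langevin_sd epsilon).
Local Notation J := (langevin_rate epsilon).
Local Notation m := (langevin_gauss epsilon).

Lemma langevin_rate_function : rate_function J.
Proof.
split; first by move=> x; rewrite lee_fin divr_ge0 ?addr_ge0 ?sqr_ge0// ltW.
move=> x a; rewrite lte_fin => ax.
have cJ : (fun y : R * R => (y.1 ^+ 2 + y.2 ^+ 2) / epsilon) y @[y --> x] -->
    (x.1 ^+ 2 + x.2 ^+ 2) / epsilon.
  apply: cvgM; last exact: cvg_cst.
  apply: cvgD; apply: (cvg_comp _ (fun t : R => t ^+ 2)).
  - exact: cvg_fst.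
  - exact: sqr_continuous.
  - exact: cvg_snd.
  - exact: sqr_continuous.
exists [set y | a < (y.1 ^+ 2 + y.2 ^+ 2) / epsilon]; last by move=> y; rewrite lte_fin.
exact: (cvgr_gt _ cJ).
Qed.

(** A box of half-side delta around x has mass at least (nu / (pi epsilon)) 4 delta^2
    times the exponential of - nu K, where K exceeds the rate at x by at most eta for
    small delta.  The prefactor is at least 1 once nu >= N. *)
Lemma langevin_gauss_open (U : set (R * R)) : open U ->
  (- ereal_inf (J @` U) <=
    limf_einf (fun nu : R => (nu^-1)%:E * lne (m nu U)) (pinfty_nbhs R))%E.
Proof.
move=> oU; rewrite /ereal_inf oppeK; apply: ge_ereal_sup => _ [_ [x Ux <-] <-].
apply/lee_addgt0Pr => eta eta0.
rewrite -leeBlDr//; apply: limf_einf_ge.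
have [e /= e0 eU] : exists2 e : R, 0 < e & ball x e `<=` U.
  by apply/nbhs_ballP; exact: open_nbhs_nbhs.
pose A := `|x.1| + `|x.2| + 1.
have A0 : 0 < A by rewrite ltr_wpDl// addr_ge0.
pose delta := Num.min (Num.min e 1) (eta * epsilon / (2 * A)).
have d0 : 0 < delta.
  by rewrite !lt_min e0 ltr01/= divr_gt0// ?mulr_gt0.
have de : delta <= e by rewrite !ge_min lexx.
have d1 : delta <= 1 by rewrite !ge_min lexx orbT.
have dA : delta * (2 * A) <= eta * epsilon.
  by rewrite -ler_pdivlMr ?mulr_gt0// ge_min lexx orbT.
have mU := open_measurable_plane _ oU.
pose Q : set (R * R) := `](x.1 - delta), (x.1 + delta)[%classic `*`
                        `](x.2 - delta), (x.2 + delta)[%classic.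
have QU : Q `<=` U.
  move=> y [] /=; rewrite !in_itv/= => /andP[y1 y2] /andP[y3 y4]; apply: eU.
  by split => /=; rewrite /ball/= ltr_distlC; apply/andP; split; lra.
pose K := ((`|x.1| + delta) ^+ 2 + (`|x.2| + delta) ^+ 2) / epsilon.
have KJ : K <= (x.1 ^+ 2 + x.2 ^+ 2) / epsilon + eta.
  rewrite /K ler_pdivrMr// mulrDl divfK ?gt_eqF//.
  rewrite -(real_normK (num_real x.1)) -(real_normK (num_real x.2)).
  by move: dA d1 d0; rewrite /A; nra.
pose N := pi * epsilon / (4 * delta ^+ 2).
near=> nu.
have nu0 : 0 < nu by near: nu; exact: nbhs_pinfty_gt.
have nuN : N <= nu by near: nu; apply: nbhs_pinfty_ge; exact: num_real.
have s0 : sd nu != 0 by exact: (langevin_sd_neq0 _ epsilon_gt0).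
have nn := lt0r_neq0 nu0; have en := lt0r_neq0 epsilon_gt0.
have s2 : sd nu ^+ 2 *+ 2 = epsilon / nu.
  by rewrite langevin_sd_sqr//; field; exact: lt0r_neq0.
have low : ((expR (- (nu * K)))%:E <= m nu U)%E.
  apply: (@le_trans _ _ (m nu Q)); last first.
    by apply: le_measure; rewrite ?inE//; exact: measurableX.
  have -> : (m nu Q = gauss (sd nu) `](x.1 - delta)%R, (x.1 + delta)%R[%classic *
      gauss (sd nu) `](x.2 - delta)%R, (x.2 + delta)%R[%classic)%E.
    exact: product_measure1E.
  have H1 := gauss_itv_ge _ x.1 _ s0 d0; have H2 := gauss_itv_ge _ x.2 _ s0 d0.
  apply: le_trans (lee_pmul _ _ H1 H2); last 2 first.
  - by rewrite lee_fin !mulr_ge0 ?normal_peak_ge0 ?expR_ge0// ltW.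
  - by rewrite lee_fin !mulr_ge0 ?normal_peak_ge0 ?expR_ge0// ltW.
  rewrite -EFinM lee_fin mulrACA -expRD.
  have -> : - (`|x.1| + delta) ^+ 2 / (sd nu ^+ 2 *+ 2) +
      - (`|x.2| + delta) ^+ 2 / (sd nu ^+ 2 *+ 2) = - (nu * K).
    by rewrite s2 /K; field; rewrite ?nn ?en.
  rewrite ler_peMl ?expR_ge0//.
  have peak2 : normal_peak (sd nu) ^+ 2 = nu / (epsilon * pi).
    rewrite /normal_peak exprVn sqr_sqrtr; last first.
      by rewrite mulrn_wge0// mulr_ge0 ?sqr_ge0// pi_ge0.
    have p0 := lt0r_neq0 (pi_gt0 R).
    rewrite -mulrnAl s2; move: (@pi R) p0 => p p0.
    by field; rewrite ?p0 ?nn ?en.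
  rewrite -expr2 exprMn peak2.
  have : N <= nu := nuN.
  rewrite /N ler_pdivrMr ?mulr_gt0 ?exprn_gt0// => H.
  rewrite mulrA ler_pdivlMr ?mulr_gt0 ?pi_gt0// mul1r.
  by move: H; move: (@pi R) => p; lra.
apply: (@le_trans _ _ ((nu^-1)%:E * (- (nu * K))%:E)%E).
  rewrite -EFinM mulrN mulKf ?gt_eqF// -EFinD lee_fin; move: KJ; lra.
rewrite lee_pmul2l ?lte_fin ?invr_gt0//.
have -> : ((- (nu * K))%:E = lne (expR (- (nu * K)))%:E)%E.
  by rewrite lne_EFin ?expR_gt0// expRK.
rewrite lee_lne//.
  by rewrite in_itv/= lee_fin expR_ge0 leey.
by rewrite in_itv/= measure_ge0 leey.
Unshelve. all: by end_near. Qed.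

Lemma measurable_rate_superlevel (i : R) :
  measurable [set x : R * R | i <= (x.1 ^+ 2 + x.2 ^+ 2) / epsilon].
Proof.
have mq : measurable_fun setT (fun x : R * R => (x.1 ^+ 2 + x.2 ^+ 2) / epsilon).
  apply: measurable_funM => //; apply: measurable_funD.
    exact: (measurableT_comp (exprn_measurable _) measurable_fst).
  exact: (measurableT_comp (exprn_measurable _) measurable_snd).
have := mq measurableT `[i, +oo[%classic (measurable_itv _); rewrite setTI.
by congr measurable; apply/seteqP; split => x /=; rewrite in_itv/= andbT.
Qed.

(** Exponential Chebyshev inequality: the exponential moment of
    (1 - a^2) nu |x|^2 / epsilon is a^-2, whatever nu. *)
Lemma langevin_gauss_ge_le (nu i a : R) : 0 < nu -> 0 < a -> a <= 1 ->
  (m nu [set x | (i <= (x.1 ^+ 2 + x.2 ^+ 2) / epsilon)%R] <=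
   (a^-1 ^+ 2 * expR (- ((1 - a ^+ 2) * nu * i)))%:E)%E.
Proof.
move=> nu0 a0 a1.
have s0 : sd nu != 0 by exact: (langevin_sd_neq0 _ epsilon_gt0).
have nn := lt0r_neq0 nu0; have en := lt0r_neq0 epsilon_gt0.
have s2 : sd nu ^+ 2 *+ 2 = epsilon / nu by rewrite langevin_sd_sqr//; field.
pose c := 1 - a ^+ 2.
have c0 : 0 <= c by rewrite subr_ge0 exprn_ile1// ltW.
pose g (t : R) := expR (c * t ^+ 2 / (sd nu ^+ 2 *+ 2)).
have mg : measurable_fun setT g.
  have mq : measurable_fun setT (fun t : R => c * t ^+ 2 / (sd nu ^+ 2 *+ 2)).
    by do 2 apply: measurable_funM => //; exact: exprn_measurable.
  exact: (measurableT_comp (@measurable_expR R) mq).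
have mgE : measurable_fun setT (EFin \o g) by exact/measurable_EFinP.
have ig : (\int[gauss (sd nu)]_t (g t)%:E = a^-1%:E)%E by exact: gauss_expR_sqr.
have mgg : measurable_fun setT (fun x : R * R => (g x.1 * g x.2)%:E).
  by apply/measurable_EFinP; apply: measurable_funM;
    [exact: (measurableT_comp mg measurable_fst)
    |exact: (measurableT_comp mg measurable_snd)].
have igg : (\int[m nu]_x (g x.1 * g x.2)%:E = (a^-1 ^+ 2)%:E)%E.
  rewrite /langevin_gauss fubini_tonelli1//=; last first.
    by move=> x; rewrite lee_fin mulr_ge0// expR_ge0.
  transitivity (\int[gauss (sd nu)]_x ((g x)%:E * a^-1%:E))%E.
    apply: eq_integral => x _; rewrite /fubini_F -ig -ge0_integralZl//.
    - by move=> y _; rewrite lee_fin expR_ge0.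
    - by rewrite lee_fin expR_ge0.
  rewrite ge0_integralZr//.
  - by rewrite ig -EFinM expr2.
  - by move=> y _; rewrite lee_fin expR_ge0.
  - by rewrite lee_fin invr_ge0 ltW.
set B := [set x : R * R | _].
have mB : measurable B by exact: measurable_rate_superlevel.
pose E := expR (c * nu * i).
have EB : (E%:E * m nu B <= (a^-1 ^+ 2)%:E)%E.
  rewrite -igg -[X in (_ * m nu X)%E]setIT -integral_indic// -ge0_integralZl//.
  - apply: ge0_le_integral => //.
    + by move=> x _; apply: mule_ge0; rewrite lee_fin// expR_ge0.
    + by apply: measurable_funeM; exact/measurable_EFinP/measurable_indic.
    move=> x _; rewrite -EFinM lee_fin indicE; have [|_] := boolP (_ \in _).
      rewrite inE mulr1 /B /= => ix; rewrite /g -expRD ler_expR s2.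
      have -> : c * x.1 ^+ 2 / (epsilon / nu) + c * x.2 ^+ 2 / (epsilon / nu)
          = c * nu * ((x.1 ^+ 2 + x.2 ^+ 2) / epsilon) by field; rewrite ?nn ?en.
      by rewrite ler_wpM2l// mulr_ge0// ltW.
    by rewrite mulr0 mulr_ge0 ?expR_ge0.
  - exact/measurable_EFinP/measurable_indic.
  - by rewrite lee_fin expR_ge0.
have -> : m nu B = (E^-1%:E * (E%:E * m nu B))%E.
  by rewrite muleA -EFinM mulVf ?gt_eqF ?expR_gt0// mul1e.
rewrite expRN mulrC EFinM; apply: lee_wpmul2l => //.
by rewrite lee_fin invr_ge0 expR_ge0.
Qed.

(** The rate on C is at least i, so the Chebyshev bound gives the decay rate
    (1 - a^2) i; the constant a^-2 vanishes in the limit, after which a tends to 0. *)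
Lemma langevin_gauss_closed (C : set (R * R)) : closed C ->
  (limf_esup (fun nu : R => (nu^-1)%:E * lne (m nu C)) (pinfty_nbhs R)
   <= - ereal_inf (J @` C))%E.
Proof.
move=> cC.
have mC : measurable C.
  by rewrite -[C]setCK; apply: measurableC; apply: open_measurable_plane;
    exact: closed_openC.
suff main i : 0 <= i -> (i%:E <= ereal_inf (J @` C))%E ->
    (limf_esup (fun nu : R => (nu^-1)%:E * lne (m nu C)) (pinfty_nbhs R) <= - i%:E)%E.
  have I0 : (0 <= ereal_inf (J @` C))%E.
    apply: le_ereal_inf_tmp => _ [x _ <-]; exact: langevin_rate_function.1.
  move: I0 main; case: (ereal_inf _) => [i| |//] I0 main; first exact: main.
  have main' r : 0 <= r -> (limf_esup (fun nu : R => (nu^-1)%:E * lne (m nu C))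
      (pinfty_nbhs R) <= - r%:E)%E by move=> r0; apply: main; rewrite ?leey.
  move: main'; case: (limf_esup _ _) => [l| |//] main'.
  - have l1 : 0 <= `|l| + 1 by rewrite addr_ge0.
    have H : l <= - (`|l| + 1) by rewrite -lee_fin; exact: main'.
    suff : l < l by rewrite ltxx.
    apply: le_lt_trans H _.
    by rewrite ltrNl (le_lt_trans (ler_norm (- l)))// normrN ltrDl.
  - by have := main' (0 : R) (lexx _); rewrite oppe0 leye_eq.
move=> i0 iC; apply/lee_addgt0Pr => eta eta0.
(* a is so small that a^2 i <= eta / 2; the other half of eta pays for a^-2 *)
pose a := Num.min (1 / 2) (eta / (2 * (i + 1))).
have i1 : 0 < 2 * (i + 1) by lra.
have a0 : 0 < a by rewrite lt_min divr_gt0//= divr_gt0.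
have a12 : a <= 1 / 2 by rewrite ge_min lexx.
have ai : a * (2 * (i + 1)) <= eta.
  by rewrite -ler_pdivlMr// ge_min lexx orbT.
pose L := ln (a^-1 ^+ 2).
apply: limf_esup_le; near=> nu.
have nu0 : 0 < nu by near: nu; exact: nbhs_pinfty_gt.
have nuL : 2 * L / eta <= nu by near: nu; apply: nbhs_pinfty_ge; exact: num_real.
have bound : (m nu C <= (expR (L - (1 - a ^+ 2) * nu * i))%:E)%E.
  have a1 : a <= 1 by lra.
  have E : expR (L - (1 - a ^+ 2) * nu * i) =
      a^-1 ^+ 2 * expR (- ((1 - a ^+ 2) * nu * i)).
    by rewrite expRD /L lnK// posrE exprn_gt0// invr_gt0.
  rewrite E; apply: le_trans (langevin_gauss_ge_le nu i a nu0 a0 a1).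
  apply: le_measure; rewrite ?inE//; first exact: measurable_rate_superlevel.
  move=> x Cx /=; rewrite -lee_fin; apply: le_trans iC _.
  by apply: ereal_inf_lbound; exists x.
apply: (@le_trans _ _ ((nu^-1)%:E * (L - (1 - a ^+ 2) * nu * i)%:E)%E).
  rewrite lee_pmul2l ?lte_fin ?invr_gt0//.
  rewrite -[X in (_ <= X%:E)%E]expRK -lne_EFin ?expR_gt0// lee_lne//.
    by rewrite in_itv/= measure_ge0 leey.
  by rewrite in_itv/= lee_fin expR_ge0 leey.
rewrite -EFinM -EFinN -EFinD lee_fin.
rewrite mulrC ler_pdivrMr//.
have nL : 2 * L <= eta * nu by move: nuL; rewrite ler_pdivrMr// [nu * _]mulrC.
have a2i : a ^+ 2 * i <= eta / 2.
  apply: (@le_trans _ _ (a * i)).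
    by rewrite ler_wpM2r// expr2 ler_piMl ?(ltW a0)//; lra.
  by move: ai a0; lra.
have := ler_wpM2r (ltW nu0) a2i; nra.
Unshelve. all: by end_near. Qed.

End gaussian_large_deviations.

(** * The theta-method driven by a Wiener process *)

Section theta_method_on_wiener.
Context {R : realType} {d : measure_display} {Omega : measurableType d}.
Variables (P : probability Omega R) (W : R -> {RV P >-> R}).
Hypothesis hW : wiener_process P W.
Variables (epsilon h : R).
Hypotheses (epsilon_gt0 : 0 < epsilon) (h_gt0 : 0 < h).

Lemma increments_independent n :
  independent_RVs P (fun i : 'I_n => increments h W i).
Proof.
apply: (wiener_independent hW (t := fun i => i%:R * h)) => [|i].
  by rewrite mul0r.
by rewrite ler_wpM2r ?ler_nat// ltW.
Qed.

Lemma increments_law n (B : set R) : measurable B ->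
  P (increments h W n @^-1` B) = gauss (Num.sqrt h) B.
Proof.
move=> mB; have n0 : 0 <= n%:R * h by rewrite mulr_ge0// ltW.
have nn : n%:R * h < n.+1%:R * h by rewrite ltr_pM2r// ltr_nat.
have := wiener_increment hW n0 nn mB.
have -> : n.+1%:R * h - n%:R * h = h by rewrite -natr1; ring.
by [].
Qed.

Lemma midpoint_unique_invariant nu : 1 <= nu ->
  unique_invariant_measure P (theta_chain 2^-1 nu h epsilon W)
    (langevin_gauss epsilon nu).
Proof.
move=> nu1; have nu0 : 0 < nu by move: nu1; lra.
rewrite theta_chainE.
have mF := measurable_theta_step 2^-1 nu h epsilon.
have inv : invariant_measure P (markov_chain P (theta_step 2^-1 nu h epsilon)
    (increments h W)) (langevin_gauss epsilon nu).
  apply: (one_step_invariant_measure P _ _ _ mF increments_independent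
    increments_law) => phi mphi phi0.
  exact: midpoint_one_step_invariant.
have half_ge : 2^-1 <= 2^-1 :> R by [].
have half_le : 2^-1 <= 1 :> R by lra.
split; first exact: inv.
move=> m' inv'; apply: (contraction_unique_invariant P _ _ mF _ _ _ inv inv').
exact: (theta_chain_contraction _ _ _ _ half_ge half_le nu1 h_gt0).
Qed.

(** Take the Chernoff parameter nu L in the half-plane p > 1/2.  The momentum
    variance is at most epsilon / (k nu^2), so the quadratic term of the exponent
    stays bounded while the linear one is - nu L / 2, with L arbitrary. *)
Lemma theta_invariant_rate_infinite (theta : R) (m : R -> probability (R * R)%type R)
    (J : R * R -> \bar R) :
  2^-1 < theta -> theta <= 1 ->
  (\forall nu \near +oo,
    unique_invariant_measure P (theta_chain theta nu h epsilon W) (m nu)) ->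
  satisfies_LDP m J -> J (1, 0) = +oo%E.
Proof.
move=> theta_gt theta_le muniq [lower _].
pose U : set (R * R) := [set x | 2^-1 < x.1].
have oU : open U.
  have -> : U = fst @^-1` [set t | 2^-1 < t] by [].
  by apply: open_comp; [move=> x _; exact: cvg_fst | exact: open_gt].
have JU : (ereal_inf (J @` U) <= J (1, 0)%R)%E.
  by apply: ereal_inf_lbound; exists (1, 0) => //=; rewrite /U /=; lra.
apply/eqyP => r r0; apply: le_trans JU.
rewrite -leeN2; apply: le_trans (lower U oU) _.
apply: limf_einf_le.
pose k := (2 * theta - 1) * h.
have k0 : 0 < k by rewrite mulr_gt0//; lra.
pose L := 2 * (r + 1).
have L0 : 0 < L by rewrite /L; lra.
near=> nu.
have nu1 : 1 <= nu by near: nu; exact: nbhs_pinfty_ge.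
have nuL : epsilon * L ^+ 2 / (2 * k) <= nu.
  by near: nu; apply: nbhs_pinfty_ge; exact: num_real.
have [inv _] : unique_invariant_measure P (theta_chain theta nu h epsilon W) (m nu).
  by near: nu.
have nu0 : 0 < nu by move: nu1; lra.
rewrite theta_chainE in inv.
have tail := theta_invariant_tail P _ _ _ _ (ltW theta_gt) theta_le nu1 h_gt0 epsilon_gt0
  _ increments_independent increments_law (m nu) (nu * L) 2^-1
  (ltW (mulr_gt0 nu0 L0)) inv.
have exponent : theta_covariance theta nu h epsilon (nu * L, 0) / 2 - nu * L * 2^-1
    <= - (nu * r).
  have S0 : k * nu ^+ 2 <= theta_damping theta nu h.
    apply: le_trans (theta_damping_ge _ _ _ (ltW theta_gt) nu1 h_gt0).
    by rewrite lerDr mulr_ge0// ltW.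
  have kn0 : 0 < k * nu ^+ 2 by rewrite mulr_gt0// exprn_gt0.
  have -> : theta_covariance theta nu h epsilon (nu * L, 0) =
      epsilon * (nu * L) ^+ 2 / theta_damping theta nu h.
    by rewrite /theta_covariance /=; ring.
  have : epsilon * (nu * L) ^+ 2 / theta_damping theta nu h <= 2 * nu.
    rewrite ler_pdivrMr ?(lt_le_trans kn0)//.
    apply: (@le_trans _ _ (2 * nu * (k * nu ^+ 2))); last first.
      by rewrite ler_wpM2l// mulr_ge0// ltW.
    have k20 : 0 < 2 * k by apply: mulr_gt0.
    move: nuL; rewrite (ler_pdivrMr _ _ k20) => H.
    have := ler_wpM2r (ltW (exprn_gt0 2 nu0)) H.
    rewrite exprMn; nra.
  by rewrite /L; nra.
have mU : (m nu U <= (expR (- (nu * r)))%:E)%E.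
  by apply: le_trans tail _; rewrite lee_fin ler_expR.
apply: (@le_trans _ _ ((nu^-1)%:E * (- (nu * r))%:E)%E).
  rewrite lee_pmul2l ?lte_fin ?invr_gt0//.
  rewrite -[X in (_ <= X%:E)%E]expRK -lne_EFin ?expR_gt0// lee_lne//.
    by rewrite in_itv/= measure_ge0 leey.
  by rewrite in_itv/= lee_fin expR_ge0 leey.
by rewrite -EFinM mulrN mulKf ?gt_eqF// EFinN.
Unshelve. all: by end_near. Qed.

End theta_method_on_wiener.

Theorem theorem5p3 (R : realType) (d : measure_display)
    (Omega : measurableType d) (P : probability Omega R)
    (W : R -> {RV P >-> R}) (hW : wiener_process P W)
    (epsilon : R) (hepsilon : 0 < epsilon)
    (theta : R) (htheta : 2^-1 <= theta <= 1) :
  asymptotically_preserves_LDP P epsilon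
    (fun nu h => theta_chain theta nu h epsilon W)
  <-> theta = 2^-1.
Proof.
have /andP[theta_ge theta_le] := htheta.
split=> [[h0 h00 [J [HJ Jlim]]]|->].
  apply/eqP; apply: contraT => theta_neq.
  have theta_gt : 2^-1 < theta by rewrite lt_neqAle eq_sym theta_neq.
  have Jy h : 0 < h -> h <= h0 -> J h (1, 0) = +oo%E.
    move=> hp hle; have [m [mu _ mL]] := HJ h hp hle.
    exact: (theta_invariant_rate_infinite P W hW epsilon h hepsilon hp theta m).
  have : J h (1, 0) @[h --> 0^'+] --> +oo%E.
    apply: cvg_near_cst; near=> h; apply: Jy => //.
    by near: h; exact: nbhs_right_le.
  move=> Jy'; have : langevin_rate epsilon (1, 0) = +oo%E.
    exact: (cvg_unique (@ereal_hausdorff R) (Jlim (1, 0)) Jy').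
  by rewrite /langevin_rate; discriminate.
exists 1 => //; exists (fun=> langevin_rate epsilon); split; last first.
  by move=> x; exact: cvg_cst.
move=> h hp _; exists (langevin_gauss epsilon); split.
- apply: filterS (nbhs_pinfty_ge (num_real (1 : R))) => nu nu1.
  exact: midpoint_unique_invariant.
- exact: langevin_rate_function.
- by split; [exact: langevin_gauss_open|exact: langevin_gauss_closed].
Unshelve. all: by end_near. Qed.
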